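(* Let $\Gamma$, $\xi$, $q$, $V_\xi\Gamma$, $T\Gamma$, $S(E_0)$, $\phi^t$, $\mu_\xi$ and $\mu$ be as in the context. Let $(z_0,\widehat v_0)\in\mathbb C\times T\Gamma$ be such that $\phi^{-\log q}[z_0,\widehat v_0,1]=[z_0,\widehat v_0,1]$ in $S(E_0)$, and let $\gamma\in\xi^{-1}\Gamma$ be such that $\xi^{-1}z_0=z_0+\gamma$ and $\xi^{-1}\widehat v_0=\widehat v_0-\gamma$. 1) The maps $z\in\mathbb C\mapsto\xi^{-1}z-\gamma-z$ and $\widehat v\in V_\xi\Gamma\mapsto\xi^{-1}\widehat v+\gamma-\widehat v$ are invertible, and their Jacobians are respectively $$\mathrm{Jac}(\xi^{-1}z-\gamma-z)=|\xi^{-1}-1|^2,\qquad \mathrm{Jac}(\xi^{-1}\widehat v+\gamma-\widehat v)=q.$$ 2) Let $\mathcal V$ be an open neighborhood of $(z_0,\widehat v_0)$ and set $$U=\{(z,\widehat v,e^{-s}):\ s\in\,]-\log q,0],\ (z,\widehat v)\in \mathcal V\}.$$ Let $\epsilon>0$ and $\mathcal V$ be small enough so that $t\in[-\log q,0]\mapsto(z_0,\widehat v_0,e^{-t})$ is the only closed orbit of $\phi^t$ contained in $U$ with length in $]-\epsilon-\log q,\epsilon-\log q[$. Then one has the following equality of distributions on $U\times\,]-\epsilon-\log q,\epsilon-\log q[$: $$\delta_{\phi^t(y)=y}=\frac1{|\xi^{-1}-1|^2}\,\delta_{z-z_0}\otimes\frac1q\,\delta_{\widehat v-\widehat v_0}\otimes\delta_{t+\log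 q}.$$
   Context: Setup. Let $E_0$ be an elliptic curve over the finite field $\mathbb F_q$, $q=p^r$, with $q$-th power Frobenius $\phi_0$. There is a lift $(\mathcal E,\phi)$ of $(E_0,\phi_0)$ over a complete local integral domain $R$ with residue field $\mathbb F_q$ and field of fractions $L$ a finite extension of $\mathbb Q_p$. Fix an embedding $L\subset\mathbb C$, let $E=\mathcal E\otimes_RL$ be the generic fibre, let $\Gamma\subset\mathbb C$ be the period lattice of a nonzero holomorphic one-form on $E(\mathbb C)$, so $E(\mathbb C)\simeq\mathbb C/\Gamma$, and let $\xi\in\mathbb C$ be the complex number such that $\phi\otimes L$ corresponds to multiplication by $\xi$ on $\mathbb C/\Gamma$. Thus $\xi\Gamma\subset\Gamma$ and $|\xi|^2=q$. Set $V=\bigcup_{n\in\mathbb N}\xi^{-n}\Gamma$, $T\Gamma=\varprojlim_n\Gamma/\xi^n\Gamma$ and $V_\xi\Gamma=T\Gamma\otimes_{\mathbb Z}\mathbb Q$ (on which multiplication by $\xi$ is an automorphism); $V\subset\Gamma\otimes\mathbb Q$ maps naturally to $V_\xi\Gamma$. The group $V$ acts on $\mathbb C\times V_\xi\Gamma$ by $v\cdot(z,\widehat v)=(z+v,\widehat v-v)$. $q^{\mathbb Z}$ acts on $\frac{\mathbb C\times V_\xi\Gamma}{V}\times\mathbb R^{+*}$ by $q^\nu\cdot([z,\widehat v],x)=([\xi^\nu z,\xi^\nu\widehat v],xq^\nu)$, and $S(E_0)=\frac{\mathbb C\times V_\xi\Gamma}{V}\times_{q^{\mathbb Z}}\mathbb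 R^{+*}$ is the quotient. The flow is $\phi^t([z,\widehat v,x])=[z,\widehat v,xe^{-t}]$. $\mu_\xi$ is a Haar measure on $V_\xi\Gamma$, and $\mu$ is the ($\phi^t$-invariant) measure on $S(E_0)$ induced by $dx_1dx_2\otimes\mu_\xi\otimes\frac{dx}{x}$ ($z=x_1+ix_2$). Jacobians are taken with respect to $dx_1dx_2$ on $\mathbb C$ and $\mu_\xi$ on $V_\xi\Gamma$ (factor by which the measure is scaled). Distribution $\delta_{\phi^t(y)=y}$. $\delta_{\phi^t(y)=y'}$ is the Schwartz kernel, with respect to $\mu$, of $(\phi^t)^*$ on functions: $f(\phi^t(y))=\int_{S(E_0)}\delta_{\phi^t(y)=y'}f(y')\,d\mu(y')$, and $\delta_{\phi^t(y)=y}$ is its restriction to $y'=y$, seen as a distribution in $(y,t)$. Points of $U$ are regarded as points of $S(E_0)$; for $y=[z,\widehat v,x]$ near the closed orbit $\{\phi^t[z_0,\widehat v_0,1]:-\log q\le t\le0\}$ one has $\phi^t(y)=(\xi^{-1}z-\gamma,\xi^{-1}\widehat v+\gamma,q^{-1}xe^{-t})$ in the same coordinates. Concretely $\delta_{\phi^t(y)=y}$ is then the pullback of the Dirac distribution at $0$ of $\mathbb C\times V_\xi\Gamma\times\mathbb R$ (with measure $dx_1dx_2\otimes\mu_\xi\otimes du$, $u=\log x$) by the difference map $(z,\widehat v,x,t)\mapsto(\xi^{-1}z-\gamma-z,\ \xi^{-1}\widehat v+\gamma-\widehat v,\ -\log q-t)$. On the totally disconnected factor test functions are locally constant with compact support.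 $\delta_{z-z_0}$, $\delta_{\widehat v-\widehat v_0}$, $\delta_{t+\log q}$ are the Dirac distributions at $z_0$, $\widehat v_0$, $-\log q$ with respect to $dx_1dx_2$, $\mu_\xi$, $dt$. Lengths here are signed (the orbit above is traversed in time $-\log q$). *)

(* Defs.v *)
From HB Require Import structures.
From mathcomp Require Import all_boot all_order all_algebra.
From mathcomp Require Import all_classical all_reals all_analysis.
From mathcomp Require Import complex.
From mathcomp Require Import generic_quotient zify.
Import Order.TTheory GRing.Theory Num.Theory numFieldNormedType.Exports.
Set Implicit Arguments.
Unset Strict Implicit.
Unset Printing Implicit Defensive.
Local Open Scope classical_set_scope.
Local Open Scope ring_scope.
Local Open Scope complex_scope.
Local Open Scope quotient_scope.

(* R[i] carries no topology in real-closed; this one has the balls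
   `|x - y| < e as a basis. *)
HB.instance Definition _ (R : realType) := Topological.copy R[i] R[i]^o.

Section Rationalization.
Variable A : zmodType.

(* A (x) Q, as the localization of the Z-module A at the nonzero integers:
   the pair (a, m) stands for a (x) 1/(m+1). *)
Definition Qfrac : Type := (A * nat)%type.
HB.instance Definition _ := Choice.on Qfrac.

Definition Qeqv (u v : Qfrac) : bool :=
  `[< exists k, u.1 *+ (v.2.+1 * k.+1) = v.1 *+ (u.2.+1 * k.+1) >].

Lemma Qeqv_refl : reflexive Qeqv.
Proof. by move=> u; apply/asboolP; exists 0%N. Qed.

Lemma Qeqv_sym : symmetric Qeqv.
Proof. by move=> u v; apply/asboolP/asboolP => -[k e]; exists k. Qed.

Lemma Qeqv_trans : transitive Qeqv.
Proof.
move=> v u w /asboolP[k e1] /asboolP[l e2]; apply/asboolP.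
exists (v.2.+1 * (k.+1 * l.+1)).-1; rewrite prednK ?muln_gt0//.
have -> : (w.2.+1 * (v.2.+1 * (k.+1 * l.+1)) =
  (v.2.+1 * k.+1) * (w.2.+1 * l.+1))%N by lia.
have -> : (u.2.+1 * (v.2.+1 * (k.+1 * l.+1)) =
  (v.2.+1 * l.+1) * (u.2.+1 * k.+1))%N. by lia.
by rewrite mulrnA e1 -mulrnA mulnC mulrnA e2 -mulrnA.
Qed.

Canonical Qeqv_equiv := EquivRel Qeqv Qeqv_refl Qeqv_sym Qeqv_trans.

Definition tensorQ : Type := {eq_quot Qeqv}.
HB.instance Definition _ := Choice.on tensorQ.
HB.instance Definition _ := EqQuotient.on tensorQ.

Definition Qdiv (a : A) (m : nat) : tensorQ := \pi_tensorQ ((a, m) : Qfrac).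

Lemma Qdiv_eq a m b n k : a *+ (n.+1 * k.+1) = b *+ (m.+1 * k.+1) ->
  Qdiv a m = Qdiv b n.
Proof. by move=> e; apply/eqmodP/asboolP; exists k. Qed.

Lemma Qdiv_eqP a m b n : Qdiv a m = Qdiv b n ->
  exists k, a *+ (n.+1 * k.+1) = b *+ (m.+1 * k.+1).
Proof. by move=> /eqmodP/asboolP. Qed.

Lemma QdivP (u : tensorQ) : u = Qdiv (repr u).1 (repr u).2.
Proof. by rewrite /Qdiv -surjective_pairing reprK. Qed.

Definition Qadd (u v : tensorQ) : tensorQ :=
  Qdiv ((repr u).1 *+ (repr v).2.+1 + (repr v).1 *+ (repr u).2.+1)
       ((repr u).2.+1 * (repr v).2.+1).-1.
Definition Qopp (u : tensorQ) : tensorQ := Qdiv (- (repr u).1) (repr u).2.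

Lemma Qadd_div a m b n :
  Qadd (Qdiv a m) (Qdiv b n) = Qdiv (a *+ n.+1 + b *+ m.+1) (m.+1 * n.+1).-1.
Proof.
rewrite /Qadd; move: (QdivP (Qdiv a m)) (QdivP (Qdiv b n)).
set a' := (repr (Qdiv a m)).1; set m' := (repr (Qdiv a m)).2.
set b' := (repr (Qdiv b n)).1; set n' := (repr (Qdiv b n)).2.
move=> /Qdiv_eqP[k e] /Qdiv_eqP[l f].
apply: (@Qdiv_eq _ _ _ _ (k.+1 * l.+1).-1); rewrite !prednK ?muln_gt0//.
rewrite !mulrnDl -!mulrnA; congr (_ + _).
  have -> : (n'.+1 * (m.+1 * n.+1 * (k.+1 * l.+1)) =
    (m.+1 * k.+1) * (n'.+1 * n.+1 * l.+1))%N by lia.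
  have -> : (n.+1 * (m'.+1 * n'.+1 * (k.+1 * l.+1)) =
    (m'.+1 * k.+1) * (n'.+1 * n.+1 * l.+1))%N by lia.
  by rewrite mulrnA -e -mulrnA.
have -> : (m'.+1 * (m.+1 * n.+1 * (k.+1 * l.+1)) =
  (n.+1 * l.+1) * (m'.+1 * m.+1 * k.+1))%N by lia.
have -> : (m.+1 * (m'.+1 * n'.+1 * (k.+1 * l.+1)) =
  (n'.+1 * l.+1) * (m'.+1 * m.+1 * k.+1))%N by lia.
by rewrite mulrnA -f -mulrnA.
Qed.

Lemma Qopp_div a m : Qopp (Qdiv a m) = Qdiv (- a) m.
Proof.
rewrite /Qopp; move: (QdivP (Qdiv a m)) => /Qdiv_eqP[k e].
by apply: (@Qdiv_eq _ _ _ _ k); rewrite !mulNrn e.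
Qed.

Lemma QaddA : associative Qadd.
Proof.
move=> u v w; rewrite (QdivP u) (QdivP v) (QdivP w) !Qadd_div.
apply: (@Qdiv_eq _ _ _ _ 0%N); rewrite !muln1 !prednK ?muln_gt0//.
rewrite mulnA; congr (_ *+ _); rewrite !mulrnDl -!mulrnA addrA.
by congr (_ + _ + _); rewrite mulnC.
Qed.

Lemma QaddC : commutative Qadd.
Proof.
move=> u v; rewrite (QdivP u) (QdivP v) !Qadd_div.
by rewrite addrC mulnC.
Qed.

Lemma Qadd0 : left_id (Qdiv 0 0) Qadd.
Proof.
move=> u; rewrite (QdivP u) Qadd_div mul0rn add0r mul1n.
exact: (@Qdiv_eq _ _ _ _ 0%N).
Qed.

Lemma QaddN : left_inverse (Qdiv 0 0) Qopp Qadd.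
Proof.
move=> u; rewrite (QdivP u) Qopp_div Qadd_div mulNrn addNr.
by apply: (@Qdiv_eq _ _ _ _ 0%N); rewrite !mul0rn.
Qed.

HB.instance Definition _ :=
  GRing.isZmodule.Build tensorQ QaddA QaddC Qadd0 QaddN.

End Rationalization.

(* f (x) Q; independent of the representative when f is additive. *)
Definition Qmap (A B : zmodType) (f : A -> B) (u : tensorQ A) : tensorQ B :=
  Qdiv (f (repr u).1) (repr u).2.

(* Gamma = Z w1 + Z w2 with w1, w2 linearly independent over the reals. *)
Definition is_lattice (R : realType) (G : set R[i]) : Prop :=
  exists w1 w2 : R[i],
    (forall a b : R, a%:C * w1 + b%:C * w2 = 0 -> a = 0 /\ b = 0) /\
    G = [set z | exists m n : int, z = m%:~R * w1 + n%:~R * w2].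

(* The complex side of a lift (E, phi) of an elliptic curve over F_q and of its
   Frobenius: the period lattice of E(C) and the multiplier xi by which phi acts
   on C / Gamma. S(E_0) and its flow depend on nothing else. *)
Record frobLattice (R : realType) := FrobLattice {
  fl_p : nat;
  fl_r : nat;
  fl_prime : prime fl_p;
  fl_r_gt0 : (0 < fl_r)%N;
  Gam : set R[i];
  Gam_lattice : is_lattice Gam;
  xi : R[i];
  xi_stable : forall g, Gam g -> Gam (xi * g);
  xi_norm : `|xi| ^+ 2 = ((fl_p ^ fl_r)%N)%:R :> R[i]
}.

Definition fl_q (R : realType) (D : frobLattice R) : nat := (fl_p D ^ fl_r D)%N.

Section TateModule.
Context {R : realType} (D : frobLattice R).
Local Notation C := R[i].
Local Notation G := (Gam D).
Local Notation x := (xi D).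

Lemma Gam0 : G 0.
Proof.
have [w1 [w2 [_ ->]]] := Gam_lattice D; exists 0, 0.
by rewrite !mul0r addr0.
Qed.

Lemma GamD g h : G g -> G h -> G (g + h).
Proof.
have [w1 [w2 [_ ->]]] := Gam_lattice D => -[m [n ->]] [k [l ->]].
by exists (m + k), (n + l); rewrite !rmorphD/= !mulrDl addrACA.
Qed.

Lemma GamN g : G g -> G (- g).
Proof.
have [w1 [w2 [_ ->]]] := Gam_lattice D => -[m [n ->]].
by exists (- m), (- n); rewrite !rmorphN/= !mulNr opprD.
Qed.

Lemma GamX n g : G g -> G (x ^+ n * g).
Proof.
elim: n => [|n ih] Gg; first by rewrite mul1r.
by rewrite exprS -mulrA; apply/xi_stable/ih.
Qed.

Definition coset (n : nat) (g : C) : set C :=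
  [set z | exists2 h, G h & z = g + x ^+ n * h].

Lemma coset_refl n g : coset n g g.
Proof. by exists 0; [exact: Gam0|rewrite mulr0 addr0]. Qed.

Lemma coset_eq n g h : coset n g h -> coset n h = coset n g.
Proof.
move=> [k Gk ->]; apply/seteqP; split=> _ [l Gl ->].
  by exists (k + l); [exact: GamD|rewrite mulrDr addrA].
exists (l - k); first exact: (GamD Gl (GamN Gk)).
by rewrite mulrBr addrACA subrr addr0.
Qed.

Lemma cosetS n g h : coset n.+1 g h -> coset n g h.
Proof.
by move=> [k Gk ->]; exists (x * k); [exact: xi_stable|rewrite exprSr mulrA].
Qed.

(* An element of lim_n Gamma / xi^n Gamma is the nested sequence of its
   components, which are cosets of xi^n Gamma in Gamma. *)
Definition coherent (a : nat -> set C) : Prop := forall n,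
  (exists2 g, G g & a n = coset n g) /\ a n.+1 `<=` a n.

Record tate := Tate { tseq : nat -> set C; tseqP : coherent tseq }.
HB.instance Definition _ := gen_eqMixin tate.
HB.instance Definition _ := gen_choiceMixin tate.

Lemma tate_ext (a b : tate) : (forall n, tseq a n = tseq b n) -> a = b.
Proof.
case: a b => [a ha] [b hb]/= /funext e; subst b; congr Tate.
exact: Prop_irrelevance.
Qed.

Lemma tate_rep (a : tate) n : exists2 g, G g & tseq a n = coset n g.
Proof. by have [] := tseqP a n. Qed.

Lemma coherent_coset g : G g -> coherent (fun n => coset n g).
Proof. by move=> Gg n; split; [exists g|exact: cosetS]. Qed.

Lemma coherentP (a : nat -> set C) :
  (forall n, exists2 g, G g & exists2 h, coset n g h &
     a n = coset n g /\ a n.+1 = coset n.+1 h) -> coherent a.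
Proof.
move=> ha n; have [g Gg [h gh [e1 e2]]] := ha n; split; first by exists g.
by rewrite e1 e2 -(coset_eq gh); exact: cosetS.
Qed.

Lemma tate_rep2 (a : tate) n : exists2 g, G g & exists2 h, G h &
  [/\ coset n g h, tseq a n = coset n g & tseq a n.+1 = coset n.+1 h].
Proof.
have [[g Gg e] s] := tseqP a n; have [h Gh f] := tate_rep a n.+1.
exists g => //; exists h => //; split=> //.
by rewrite -e; apply: s; rewrite f; exact: coset_refl.
Qed.

Definition setadd (A B : set C) : set C := [set u + v | u in A & v in B].

Lemma cosetD n g h : setadd (coset n g) (coset n h) = coset n (g + h).
Proof.
apply/seteqP; split=> [_ [_ [k Gk ->] [_ [l Gl ->] <-]]|_ [k Gk ->]]/=.
  by exists (k + l); [exact: GamD|rewrite mulrDr addrACA].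
exists (g + x ^+ n * k); first by exists k.
by exists h; [exact: coset_refl|rewrite addrAC].
Qed.

Lemma cosetN n g : [set - u | u in coset n g] = coset n (- g).
Proof.
apply/seteqP; split=> [_ [_ [k Gk ->] <-]|_ [k Gk ->]]/=.
  by exists (- k); [exact: GamN|rewrite opprD mulrN].
exists (g + x ^+ n * - k); first by exists (- k) => //; exact: GamN.
by rewrite mulrN opprB addrC.
Qed.

Lemma coset_xi n g :
  setadd [set x * u | u in coset n g] (coset n 0) = coset n (x * g).
Proof.
apply/seteqP; split=> [_ [_ [_ [k Gk ->] <-] [_ [l Gl ->] <-]]|_ [k Gk ->]]/=.
  exists (x * k + l); first by apply: GamD => //; exact: xi_stable.
  by rewrite add0r !mulrDr addrA mulrCA.
exists (x * g); first by exists g => //; exact: coset_refl.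
by exists (x ^+ n * k) => //; exists k => //; rewrite add0r.
Qed.

Lemma coherent_add (a b : tate) :
  coherent (fun n => setadd (tseq a n) (tseq b n)).
Proof.
apply: coherentP => n; have [g Gg [h Gh [gh e1 e2]]] := tate_rep2 a n.
have [g' Gg' [h' Gh' [gh' f1 f2]]] := tate_rep2 b n.
exists (g + g'); first exact: GamD.
exists (h + h'); first by rewrite -cosetD; exists h => //; exists h'.
by rewrite e1 e2 f1 f2 !cosetD.
Qed.

Lemma coherent_opp (a : tate) : coherent (fun n => [set - u | u in tseq a n]).
Proof.
apply: coherentP => n; have [g Gg [h Gh [gh e1 e2]]] := tate_rep2 a n.
exists (- g); first exact: GamN.
exists (- h); first by rewrite -cosetN; exists h.
by rewrite e1 e2 !cosetN.
Qed.

Lemma coherent_xi (a : tate) :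
  coherent (fun n => setadd [set x * u | u in tseq a n] (coset n 0)).
Proof.
apply: coherentP => n; have [g Gg [h Gh [gh e1 e2]]] := tate_rep2 a n.
exists (x * g); first exact: xi_stable.
exists (x * h).
  rewrite -coset_xi; exists (x * h); first by exists h.
  by exists 0; [exact: coset_refl|rewrite addr0].
by rewrite e1 e2 !coset_xi.
Qed.

Definition tate_zero : tate := Tate (coherent_coset Gam0).
Definition tate_add (a b : tate) : tate := Tate (coherent_add a b).
Definition tate_opp (a : tate) : tate := Tate (coherent_opp a).

Lemma tate_addA : associative tate_add.
Proof.
move=> a b c; apply: tate_ext => n /=.
have [g _ ->] := tate_rep a n; have [h _ ->] := tate_rep b n.
by have [k _ ->] := tate_rep c n; rewrite !cosetD addrA.
Qed.

Lemma tate_addC : commutative tate_add.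
Proof.
move=> a b; apply: tate_ext => n /=.
have [g _ ->] := tate_rep a n; have [h _ ->] := tate_rep b n.
by rewrite !cosetD addrC.
Qed.

Lemma tate_add0 : left_id tate_zero tate_add.
Proof.
move=> a; apply: tate_ext => n /=.
by have [g _ ->] := tate_rep a n; rewrite cosetD add0r.
Qed.

Lemma tate_addN : left_inverse tate_zero tate_opp tate_add.
Proof.
move=> a; apply: tate_ext => n /=.
by have [g _ ->] := tate_rep a n; rewrite cosetN cosetD addNr.
Qed.

HB.instance Definition _ :=
  GRing.isZmodule.Build tate tate_addA tate_addC tate_add0 tate_addN.

Definition tate_xi (a : tate) : tate := Tate (coherent_xi a).

(* Gamma -> T Gamma; the value outside Gamma is a dummy. *)
Definition tate_of (g : C) : tate :=
  if pselect (G g) is left Gg then Tate (coherent_coset Gg) else 0.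

Lemma tate_ofN g : tate_of (- g) = - tate_of g.
Proof.
rewrite /tate_of; case: pselect => [Gg|nGg]; case: pselect => [Gg'|nGg'].
- by apply: tate_ext => n /=; rewrite cosetN.
- by case: nGg'; rewrite -(opprK g); exact: GamN.
- by case: nGg; exact: GamN.
- by rewrite oppr0.
Qed.

Definition Vxi : Type := tensorQ tate.
HB.instance Definition _ := GRing.Zmodule.on Vxi.
HB.instance Definition _ := isPointed.Build Vxi 0.

Definition Vxi_of (a : tate) : Vxi := Qdiv a 0.

Definition Vxi_mul : Vxi -> Vxi := Qmap tate_xi.
(* Vxi_mul is bijective, since xi divides q = xi * xi^* on Gamma; this is its
   inverse. *)
Definition Vxi_inv (w : Vxi) : Vxi := xget 0 [set u | Vxi_mul u = w].

Definition Vxi_pow (nu : int) : Vxi -> Vxi :=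
  match nu with
  | Posz n => iter n Vxi_mul
  | Negz n => iter n.+1 Vxi_inv
  end.

(* V = \bigcup_n xi^-n Gamma, a subgroup of C. *)
Definition Vgrp : set C := [set v | exists n, G (x ^+ n * v)].

(* Restriction to V of the natural map Gamma (x) Q -> V_xi Gamma, Gamma (x) Q
   being the set of the v in C with a positive multiple (m+1) v in Gamma. *)
Definition Vnat (v : C) : Vxi :=
  let m := xget 0%N [set m | G (v *+ m.+1)] in Qdiv (tate_of (v *+ m.+1)) m.

Lemma VnatN v : Vnat (- v) = - Vnat v.
Proof.
rewrite /Vnat; have -> : [set m | G (- v *+ m.+1)] = [set m | G (v *+ m.+1)].
  apply/seteqP; split=> m /=; rewrite mulNrn; last exact: GamN.
  by move=> /GamN; rewrite opprK.
by rewrite mulNrn tate_ofN [RHS]Qopp_div.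
Qed.

(* Image in V_xi Gamma of the kernel of T Gamma -> Gamma / xi^n Gamma. *)
Definition Vxi_nbhd (n : nat) : set Vxi :=
  [set Vxi_of a | a in [set a | tseq a n 0]].

Lemma Vxi_nbhdS m n : (m <= n)%N -> Vxi_nbhd n `<=` Vxi_nbhd m.
Proof.
move=> mn _ [a a0 <-]; exists a => //=; move: a0 => /=.
elim: n m mn => [|n ih] m; first by rewrite leqn0 => /eqP->.
rewrite leq_eqVlt => /orP[/eqP-> //|mn an]; apply: (ih m mn).
by have [_] := tseqP a n; exact.
Qed.

(* The group topology for which T Gamma is open with its inverse limit
   topology. *)
Definition Vxi_open : set_system Vxi :=
  [set A | forall w, A w -> exists n, forall k, Vxi_nbhd n k -> A (w + k)].

Lemma Vxi_openT : Vxi_open setT.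
Proof. by move=> w _; exists 0%N. Qed.

Lemma Vxi_openI : setI_closed Vxi_open.
Proof.
move=> A B oA oB w [/oA[m hm] /oB[n hn]]; exists (maxn m n) => k hk.
by split; [apply: hm|apply: hn]; apply: Vxi_nbhdS hk;
  [exact: leq_maxl|exact: leq_maxr].
Qed.

Lemma Vxi_open_bigU (I : Type) (f : I -> set Vxi) :
  (forall i, Vxi_open (f i)) -> Vxi_open (\bigcup_i f i).
Proof.
move=> of_ w [i _ /of_[n hn]]; exists n => k /hn fk.
by exists i.
Qed.

HB.instance Definition _ :=
  isOpenTopological.Build Vxi Vxi_openT Vxi_openI Vxi_open_bigU.

Definition borelVxi := g_sigma_algebraType (@open Vxi).

Definition is_haar (mu : {measure set borelVxi -> \bar R}) : Prop :=
  [/\ forall (v : Vxi) (A : set borelVxi), measurable A ->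
        mu [set v + a | a in (A : set Vxi)] = mu A,
      forall K : set Vxi, compact K -> (mu K < +oo)%E &
      mu setT <> 0%E].

End TateModule.

Section SuspendedSpace.
Context {R : realType} (D : frobLattice R).
Local Notation C := R[i].
Local Notation V := (Vxi D).
Local Notation q := ((fl_q D)%:R : R).

(* Coordinates (z, w, x) on C * V_xi Gamma * R. *)
Definition cover : Type := (C * V * R)%type.

(* (z, w, x) |-> v . (q^nu . (z, w, x)). *)
Definition deck (nu : int) (v : C) (y : cover) : cover :=
  (xi D ^ nu * y.1.1 + v, Vxi_pow nu y.1.2 - Vnat D v, y.2 * q ^ nu).

(* The point [z, w, x] of S(E_0), as the set of its representatives. *)
Definition spt (y : cover) : set cover :=
  [set y' | exists nu v, Vgrp D v /\ y' = deck nu v y].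

Definition S_E0 : set (set cover) := [set spt y | y in [set y | 0 < y.2]].

Definition flow_lift (t : R) (y : cover) : cover := (y.1, y.2 * expR (- t)).

(* The flow phi^t on S(E_0); flow_lift commutes with deck. *)
Definition flow (t : R) (s : set cover) : set cover := flow_lift t @` s.

Definition tubeU (N : set (C * V)) : set cover :=
  [set y | N y.1 /\ exists2 s, - ln q < s <= 0 & y.2 = expR (- s)].

Definition isolated_orbit (N : set (C * V)) (eps : R) (y0 : set cover) : Prop :=
  forall (y : set cover) (l : R),
    S_E0 y -> - eps - ln q < l < eps - ln q -> l != 0 ->
    flow l y = y ->
    (forall t, exists2 u, tubeU N u & flow t y = spt u) ->
    l = - ln q /\ exists t, y = flow t y0.

Definition mapC (gam z : C) : C := (xi D)^-1 * z - gam - z.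
Definition mapV (gam : C) (w : V) : V := Vxi_inv w + Vnat D gam - w.

(* phi^t in the coordinates (z, w, x) near the closed orbit. *)
Definition flow_chart (gam : C) (t : R) (y : cover) : cover :=
  ((xi D)^-1 * y.1.1 - gam, Vxi_inv y.1.2 + Vnat D gam,
   q^-1 * y.2 * expR (- t)).

Lemma flow_chartP gam t y : Gam D (xi D * gam) ->
  flow t (spt y) (flow_chart gam t y).
Proof.
move=> Ggam; exists (deck (-1) (- gam) y).
  exists (-1), (- gam); split => //.
  by exists 1%N; rewrite expr1 mulrN; exact: GamN.
by rewrite /flow_lift /flow_chart /deck /= VnatN opprK (mulrC y.2).
Qed.

(* (y, t) |-> phi^t(y) - y, the R^{+*} component being written in the
   coordinate u = log x. *)
Definition diff_map (gam : C) (y : C * V * (R * R)) : C * V * R :=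
  let p := y.1 in let x := y.2.1 in let t := y.2.2 in
  let y' := flow_chart gam t (p, x) in
  (y'.1.1 - p.1, y'.1.2 - p.2, ln y'.2 - ln x).

End SuspendedSpace.

Section Distributions.
Context {R : realType} (D : frobLattice R).
Local Notation C := R[i].
Local Notation V := (Vxi D).
Local Notation q := ((fl_q D)%:R : R).
Local Notation leb := (@lebesgue_measure R).

(* C^infty, through iterated directional derivatives. *)
Definition smooth (W : normedModType R) (f : W -> R) : Prop :=
  forall s : seq W,
    let g : W -> R := foldr (fun v (g : W -> R) => 'D_v g : W -> R) f s in
    continuous g /\ forall v w, derivable g w v.

(* Test functions on an open set O of C * V_xi Gamma * E: compact support in
   O, invariance under an open subgroup of V_xi Gamma (which for compact
   support is local constancy) and smoothness in the real variables. *)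
Definition test_fun (E : normedModType R) (O : set (C * V * E))
    (h : C * V * E -> R) : Prop :=
  [/\ exists2 K, compact K & K `<=` O /\ forall y, ~ K y -> h y = 0,
      exists n, forall z w k e, Vxi_nbhd n k -> h (z, w + k, e) = h (z, w, e) &
      forall w, smooth (fun a : R * R * E => h (a.1.1 +i* a.1.2, w, a.2))].

(* dx1 dx2 on C, z = x1 + i x2: Borel sets, measure, integral. *)
Definition measurableC (A : set C) : Prop :=
  measurable [set a : R * R | A (a.1 +i* a.2)].
Definition lebC (A : set C) : \bar R :=
  (leb \x leb)%E [set a : R * R | A (a.1 +i* a.2)].
Definition intC (f : C -> R) : R :=
  \int[(leb \x leb)%E]_a f (a.1 +i* a.2).

Definition has_jacobianC (f : C -> C) (c : R) : Prop :=
  forall A, measurableC A -> lebC (f @` A) = (c%:E * lebC A)%E.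

Variable mu : {measure set (borelVxi D) -> \bar R}.

Definition has_jacobianV (f : V -> V) (c : R) : Prop :=
  forall A : set (borelVxi D), measurable A ->
    mu (f @` (A : set V)) = (c%:E * mu A)%E.

(* Integral against dx1 dx2 (x) mu_xi (x) dx / x. *)
Definition int_cover (f : cover D -> R) : R :=
  \int[mu]_w intC (fun z =>
    \int[leb]_(x in `]0, +oo[) (f (z, w, x) / x)).

(* Integral against mu (x) dt on U * I. *)
Definition int_tube (U : set (cover D)) (I : set R)
    (f : C * V * (R * R) -> R) : R :=
  int_cover (fun y => \1_U y * \int[leb]_(t in I) f (y.1, (y.2, t))).

(* Integral against dx1 dx2 (x) mu_xi (x) du. *)
Definition int_target (f : C * V * R -> R) : R :=
  \int[mu]_w intC (fun z => \int[leb]_u f (z, w, u)).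

(* Sequences of test functions converging to the Dirac distribution at 0. *)
Definition dirac_seq (rho : nat -> C * V * R -> R) : Prop :=
  [/\ forall n, test_fun (E := R) setT (rho n),
      forall n y, 0 <= rho n y,
      forall n, int_target (rho n) = 1 &
      forall N, nbhs (0 : C, 0 : V, 0 : R) N ->
        \forall n \near \oo, forall y, rho n y != 0 -> N y].

(* Test functions on U * I, where U = N * [1, q[: restrictions of test
   functions on N * R^{+*} * I. *)
Definition tube_test (N : set (C * V)) (I : set R) (h : C * V * (R * R) -> R)
    : Prop :=
  test_fun (E := (R * R)%type)
    [set y : C * V * (R * R) | [/\ N y.1, 0 < y.2.1 & I y.2.2]] h.

(* The pull-back of the Dirac distribution at 0 by F is the limit of the
   functions rho_n \o F, for every Dirac sequence rho_n. *)
Definition pullback_dirac_eq (N : set (C * V)) (I : set R)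
    (F : C * V * (R * R) -> C * V * R)
    (T : (C * V * (R * R) -> R) -> R) : Prop :=
  forall rho, dirac_seq rho -> forall h, tube_test N I h ->
    (fun n => int_tube (tubeU N) I (fun y => rho n (F y) * h y)) @ \oo --> T h.

(* delta_{z - z0} (x) delta_{w - w0} (x) delta_{t - t0}, constant in x, hence
   paired with h through the measure dx / x of U. *)
Definition dirac_orbit (z0 : C) (w0 : V) (t0 : R) (h : C * V * (R * R) -> R)
    : R :=
  \int[leb]_(x in `[1, q[) (h (z0, w0, (x, t0)) / x).

End Distributions.

(* Main.v *)
(** The difference map is, in each of the coordinates z, w and t, an affine
    bijection vanishing only at (z0, w0, - ln q), so the pulled back Dirac
    distribution is the Dirac distribution there divided by the three Jacobians.
    On C the map is the similitude of ratio xi^-1 - 1.  On V_xi Gamma it is a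
    translate of (1 - xi) xi^-1: here 1 - xi is inverted by a geometric series
    and preserves each xi^n T Gamma, while xi^-1 maps xi^(n+1) T Gamma onto
    xi^n T Gamma, which is the union of [Gamma : xi Gamma] = |xi|^2 = q of its
    cosets.  As these cosets generate the Borel sets, Haar measure is scaled
    by q.  On a small neighborhood of the fixed point a test function differs
    little from its value on the orbit, and integrating this bound against a
    Dirac sequence of known total mass gives the limit. *)
Require Import Defs.
From HB Require Import structures.
From mathcomp Require Import all_boot all_order all_algebra.
From mathcomp Require Import all_classical all_reals all_analysis.
From mathcomp Require Import complex.
From mathcomp Require Import measurable_realfun ring lra zify.
Import Order.TTheory GRing.Theory Num.Theory numFieldNormedType.Exports.
Set Implicit Arguments.
Unset Strict Implicit.
Unset Printing Implicit Defensive.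
Local Open Scope classical_set_scope.
Local Open Scope ring_scope.
Local Open Scope complex_scope.

(** * The Frobenius on the period lattice *)

(** The tensor product with Q keeps T Gamma intact only because T Gamma has no torsion, and rational
    lattice points are dense because division by an integer is continuous on T Gamma. Both come from
    one fact: every positive integer divides some xi^N (1 - xi^(k+1)) in Z[xi]. The second factor is
    invertible on T Gamma, so dividing by an integer costs only a power of xi.

    The scaling of measures is proved for preimages: A |-> mu (f^-1 A) is again a measure, and
    suitable measures agree as soon as they do on a generating family stable under intersection. The
    statements on images follow by bijectivity.

    The integral over the tube is iterated, over w, z, x, t from outside to inside. It is estimated
    in that nesting, without exchanging integrals, and one comparison lemma serves at every stage.
    The measurability needed rests on continuity in the real variables and on local constancy in
    w. *)

Lemma ord2P (j : 'I_2) : {j = 0} + {j = 1}.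
Proof. by case: j => -[|[|//]] h; [left|right]; apply/val_inj. Qed.

Section Lattice.
Context {R : realType} (D : frobLattice R).
Local Notation G := (Gam D).
Local Notation x := (xi D).
Local Notation q := (fl_q D).

Lemma fl_q_gt1 : (1 < q)%N.
Proof.
rewrite /fl_q -{1}(exp1n (fl_r D)) ltn_exp2r ?fl_r_gt0//.
exact/prime_gt1/fl_prime.
Qed.

Lemma xi_neq0 : x != 0.
Proof.
apply/eqP => x0; have := xi_norm D; rewrite x0 normr0 expr0n/= => /esym/eqP.
by rewrite pnatr_eq0 -/q; have := fl_q_gt1; case: q.
Qed.

Lemma xi_sqnorm : (complex.Re x) ^+ 2 + (complex.Im x) ^+ 2 = q%:R.
Proof.
by apply: complexI; rewrite add_Re2_Im2 xi_norm rmorph_nat.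
Qed.

Lemma intrC_complex (m : int) : (m%:~R : R[i]) = (m%:~R : R)%:C.
Proof. by rewrite rmorph_int. Qed.

(** On the real plane multiplication by xi has determinant |xi|^2 = q, and an integer matrix of it
    on a basis of the lattice has the same determinant. The characteristic equation then writes q as
    a multiple of xi and keeps all powers of xi in Z + Z xi. *)
Lemma frob_matrix : exists (w1 w2 : R[i]) (a b c d : int),
  [/\ forall m n m' n' : int, m%:~R * w1 + n%:~R * w2 =
        m'%:~R * w1 + n'%:~R * w2 -> m = m' /\ n = n',
      G = [set z | exists m n : int, z = m%:~R * w1 + n%:~R * w2],
      x * w1 = a%:~R * w1 + b%:~R * w2,
      x * w2 = c%:~R * w1 + d%:~R * w2 &
      a * d - b * c = q /\ x ^+ 2 = (a + d)%:~R * x - q%:R].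
Proof.
have [w1 [w2 [li GE]]] := Gam_lattice D.
have xw1 : G (x * w1).
  by apply: xi_stable; rewrite GE; exists 1, 0; rewrite mul1r mul0r addr0.
have xw2 : G (x * w2).
  by apply: xi_stable; rewrite GE; exists 0, 1; rewrite mul1r mul0r add0r.
move: xw1 xw2; rewrite {1 2}GE /= => -[a [b e1]] [c [d e2]].
have w10 : w1 != 0.
  apply/eqP => w0; have [] := li 1 0; first by rewrite w0 mulr0 mul0r addr0.
  by move/eqP; rewrite oner_eq0.
have w20 : w2 != 0.
  apply/eqP => w0; have [] := li 0 1; first by rewrite w0 mulr0 mul0r addr0.
  by move=> _ /eqP; rewrite oner_eq0.
(* Multiply (xi - a) w1 = b w2 by (xi - d) w2 = c w1 and cancel w1 w2. *)
have ch : (x - a%:~R) * (x - d%:~R) = b%:~R * c%:~R.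
  apply: (mulIf w10); apply: (mulIf w20).
  have -> : (x - a%:~R) * (x - d%:~R) * w1 * w2 =
    (x * w1 - a%:~R * w1) * (x * w2 - d%:~R * w2) by ring.
  by rewrite e1 e2; ring.
have det : a * d - b * c = q.
  apply/eqP; rewrite -(eqr_int R) rmorphB !rmorphM/=; apply/eqP.
  rewrite -[q%:~R]/(q%:R) -xi_sqnorm.
  move: e1 e2 ch; rewrite !intrC_complex; case: x => r s /= e1 e2 ch.
  (* If xi is real, independence of w1 and w2 makes the matrix scalar. Otherwise the imaginary part
     of [ch] gives a + d = 2 Re xi, and its real part then gives the determinant. *)
  have [s0|s0] := eqVneq s 0.
    subst s.
    have [ra b0] : r - a%:~R = 0 /\ - b%:~R = 0 :> R.
      apply: li; transitivity (r%:C * w1 - (a%:~R%:C * w1 + b%:~R%:C * w2)).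
        by ring.
      by rewrite -e1; exact: subrr.
    have [c0 rd] : - c%:~R = 0 :> R /\ r - d%:~R = 0 :> R.
      apply: li; transitivity (r%:C * w2 - (c%:~R%:C * w1 + d%:~R%:C * w2)).
        by ring.
      by rewrite -e2; exact: subrr.
    have -> : a%:~R = r by lra.
    have -> : d%:~R = r by lra.
    have -> : b%:~R = 0 :> R by lra.
    by ring.
  move: ch => /eqP; rewrite eq_complex/= => /andP[/eqP ch1 /eqP ch2].
  have /eqP : s * (r *+ 2 - a%:~R - d%:~R) = 0 by move: ch2; lra.
  rewrite mulf_eq0 (negbTE s0)/= => /eqP ad.
  have {}ad : a%:~R = r *+ 2 - d%:~R by move: ad; lra.
  by move: ch1; rewrite ad; lra.
exists w1, w2, a, b, c, d; split => //.
  move=> m n m' n' e; have [] := li (m - m')%:~R (n - n')%:~R.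
    rewrite -!intrC_complex !rmorphB/= !mulrBl.
    by rewrite addrACA -opprD e subrr.
  by move=> /eqP + /eqP; rewrite !intr_eq0 !subr_eq0 => /eqP-> /eqP->.
split => //.
have -> : (q%:R : R[i]) = (q : int)%:~R by [].
rewrite -det rmorphD rmorphB !rmorphM /=.
apply/eqP; rewrite -subr_eq0; apply/eqP.
by have := congr1 (fun z => z - b%:~R * c%:~R) ch; rewrite subrr => <-; ring.
Qed.

(* The Smith normal form of the matrix of xi splits Gam into as many cosets of
   xi Gam as its determinant tells. *)
Let Gam_cosets_fin : exists (I : finType) (c : I -> R[i]),
  [/\ #|I| = q, forall i, G (c i),
      forall g, G g -> exists i, exists2 h, G h & g = c i + x * h &
      forall i j h, G h -> c i = c j + x * h -> i = j].
Proof.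
have [w1 [w2 [a [b [c [d [li GE e1 e2 [det _]]]]]]]] := frob_matrix.
pose vl (u : 'rV[int]_2) : R[i] := (u 0 0)%:~R * w1 + (u 0 1)%:~R * w2.
have Gvl u : G (vl u) by rewrite GE; exists (u 0 0), (u 0 1).
have vlP g : G g -> exists u, g = vl u.
  rewrite GE => -[m [n ->]]; exists (\row_j if j == 0 then m else n).
  by rewrite /vl !mxE.
have vlD u v : vl (u + v) = vl u + vl v.
  by rewrite /vl !mxE !rmorphD/= !mulrDl addrACA.
have vlI : injective vl.
  move=> u v /li[h0 h1]; apply/rowP => j.
  by case: (ord2P j) => [->|->].
pose M : 'M[int]_2 := \matrix_(i, j) if i == 0 then (if j == 0 then a else b)
  else (if j == 0 then c else d).
have vlM u : vl (u *m M) = x * vl u.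
  rewrite mulrDr !(mulrCA x) e1 e2 /vl !mxE !big_ord_recl !big_ord0 !mxE/= !addr0.
  have -> : lift ord0 ord0 = 1 :> 'I_2 by apply/val_inj.
  by rewrite !rmorphD !rmorphM/=; ring.
have dM : \det M = q.
  rewrite (expand_det_row _ 0) !big_ord_recl big_ord0 /cofactor !det_mx11 !mxE/=.
  by rewrite -det addr0 expr0 expr1; ring.
(* With M = L S T and L unimodular, the sublattice Z^2 M is Z^2 S T. In the coordinates u T^-1 it is
   d0 Z + d1 Z, so pairs of residues, carried back by T, represent the cosets. *)
have [L uL [T uT [s _ ME]]] := int_Smith_normal_form M.
set S := \matrix_(i, j) _ in ME.
pose d0 := s`_0; pose d1 := s`_1.
have SE (k : 'rV[int]_2) j : (k *m S) 0 j = k 0 j * s`_j.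
  rewrite mxE (bigD1 j)//= mxE eqxx mulr1n big1 ?addr0// => i ij.
  by rewrite mxE -(inj_eq val_inj) in ij *; rewrite (negbTE ij) mulr0n mulr0.
have dS : (`|d0| * `|d1| = q)%N.
  have := congr1 absz dM; rewrite ME !det_mulmx !abszM.
  have au (N : 'M[int]_2) : N \in unitmx -> `|\det N|%N = 1%N.
    by rewrite unitmxE => /orP[] /eqP->.
  rewrite (au _ uL) (au _ uT) mul1n muln1 absz_nat => <-.
  rewrite (expand_det_row _ 0) !big_ord_recl big_ord0 /cofactor !det_mx11 !mxE/=.
  by rewrite mul0r !addr0 expr0 mul1r abszM.
have qq := fl_q_gt1.
have s0 : (0 < `|d0|)%N by rewrite lt0n; apply/eqP => z; move: dS; rewrite z; lia.
have s1 : (0 < `|d1|)%N by rewrite lt0n; apply/eqP => z; move: dS; rewrite z; lia.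
pose rw (m n : int) : 'rV[int]_2 := \row_j if j == 0 then m else n.
have rwE m n j : rw m n 0 j = if j == 0 then m else n by rewrite mxE.
exists ('I_(`|d0|) * 'I_(`|d1|))%type, 
  (fun p : 'I_(`|d0|) * 'I_(`|d1|) => vl (rw (p.1 : nat) (p.2 : nat) *m T)).
split.
- by rewrite card_prod !card_ord.
- by move=> p.
- move=> g /vlP[u ->].
  pose v := u *m invmx T; pose v0 : int := v 0 0; pose v1 : int := v 0 1.
  have b0 : (`|(v0 %% d0)%Z| < `|d0|)%N.
    have : (d0 != 0) by rewrite -absz_gt0.
    by move=> h; have := ltz_mod v0 h; have := modz_ge0 v0 h; lia.
  have b1 : (`|(v1 %% d1)%Z| < `|d1|)%N.
    have : (d1 != 0) by rewrite -absz_gt0.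
    by move=> h; have := ltz_mod v1 h; have := modz_ge0 v1 h; lia.
  exists (Ordinal b0, Ordinal b1) => /=.
  exists (vl (rw (v0 %/ d0)%Z (v1 %/ d1)%Z *m invmx L)) => //.
  rewrite -vlM -vlD; congr vl; rewrite ME !mulmxA mulmxKV// -mulmxDl.
  rewrite -[LHS](mulmxKV uT); congr (_ *m T).
  apply/rowP => j; rewrite [RHS]mxE SE !rwE.
  have n0 : d0 != 0 by rewrite -absz_gt0.
  have n1 : d1 != 0 by rewrite -absz_gt0.
  case: (ord2P j) => -> /=.
    by rewrite -[LHS]/v0 {1}(divz_eq v0 d0) addrC gez0_abs ?modz_ge0.
  by rewrite -[LHS]/v1 {1}(divz_eq v1 d1) addrC gez0_abs ?modz_ge0.
- move=> [i j] [i' j'] h /vlP[u ->] /=; rewrite -vlM -vlD => /vlI.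
  rewrite ME !mulmxA -mulmxDl => /(congr1 (mulmx^~ (invmx T))).
  rewrite !mulmxK// => e.
  have {}e k : rw (i : nat) (j : nat) 0 k = rw (i' : nat) (j' : nat) 0 k + (u *m L) 0 k * s`_k.
    by rewrite e mxE SE.
  have small (l : int) (n n' : 'I_(`|l|)) (k : int) :
      Posz n = (Posz n' + k * l)%R -> n = n'.
    rewrite addrC => nn'; have := modzMDl k n' l; rewrite -nn' -!(modz_abs _ l).
    by rewrite !modz_nat !modn_small// => -[/val_inj].
  have := e 0; have := e 1; rewrite !rwE/= => /small-> /small->.
  by [].
Qed.

Lemma Gam_cosets : exists c : 'I_q -> R[i],
  [/\ forall i, G (c i),
      forall g, G g -> exists i, exists2 h, G h & g = c i + x * h &
      forall i j h, G h -> c i = c j + x * h -> i = j].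
Proof.
have [I [c [cI Gc cP cI']]] := Gam_cosets_fin.
exists (fun i => c (enum_val (cast_ord (esym cI) i))); split => //.
  move=> g /cP[i gi]; exists (cast_ord cI (enum_rank i)).
  by rewrite cast_ordK enum_rankK.
by move=> i j h Gh /(cI' _ _ _ Gh)/enum_val_inj/cast_ord_inj.
Qed.

(* Pigeonhole for the coefficients modulo m + 1 of the powers of xi in Z[xi].
   This is what makes T Gamma torsion free and its integral multiples open. *)
Lemma xi_pow_mod (m : nat) : exists (N k : nat) (c d : int),
  x ^+ N - x ^+ (N + k.+1) = (m.+1)%:R * (c%:~R + d%:~R * x).
Proof.
have [w1 [w2 [a [b [c [d [_ _ _ _ [_ x2]]]]]]]] := frob_matrix.
have /choice[f fE] : forall n, exists p : int * int,
    x ^+ n = p.1%:~R + p.2%:~R * x.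
  elim=> [|n [[u v] /= ih]].
    by exists (1, 0) => /=; rewrite mul0r addr0 expr0.
  exists (- v * q, u + v * (a + d)) => /=.
  rewrite exprS ih; transitivity (u%:~R * x + v%:~R * x ^+ 2); first by ring.
  by rewrite x2 !(rmorphD, rmorphM, rmorphN)/=; ring.
have lm (z : int) : (`|(z %% (m.+1 : int))%Z| < m.+1)%N.
  by have := @ltz_mod z m.+1 isT; have := @modz_ge0 z m.+1 isT; lia.
pose g (n : 'I_((m.+1 * m.+1).+1)) := (Ordinal (lm (f n).1), Ordinal (lm (f n).2)).
have /injectivePn[i [j ij gij]] : ~~ injectiveb g.
  apply/negP => /injectiveP /leq_card.
  by rewrite card_prod !card_ord ltnn.
wlog lij : i j ij gij / (i < j)%N.
  move=> h; case: (ltngtP i j) => [|ji|/val_inj e]; first exact: h.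
    by apply: (h j i) => //; rewrite eq_sym.
  by rewrite e eqxx in ij.
have [e1 e2] : ((f i).1 %% m.+1 = (f j).1 %% m.+1)%Z /\
    ((f i).2 %% m.+1 = (f j).2 %% m.+1)%Z.
  move: gij => [g1 g2]; split.
    by rewrite -[LHS]gez0_abs ?modz_ge0// g1 gez0_abs ?modz_ge0.
  by rewrite -[LHS]gez0_abs ?modz_ge0// g2 gez0_abs ?modz_ge0.
have dv (u v : int) : (u %% m.+1 = v %% m.+1)%Z -> exists e, u = v + Posz m.+1 * e.
  move=> e; exists ((u %/ m.+1)%Z - (v %/ m.+1)%Z).
  move: (divz_eq u m.+1) (divz_eq v m.+1); rewrite e.
  by move: (u %/ _)%Z (v %/ _)%Z (v %% _)%Z => u' v' r -> ->; ring.
have [u1 E1] := dv _ _ e1; have [u2 E2] := dv _ _ e2.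
exists i, (j - i).-1, u1, u2.
have -> : (i + (j - i).-1.+1)%N = j by lia.
rewrite !fE E1 E2 (_ : (m.+1%:R : R[i]) = (Posz m.+1)%:~R)//.
by rewrite !(rmorphD, rmorphM)/=; ring.
Qed.

End Lattice.

(** * The Tate module *)

Section Tate.
Context {R : realType} (D : frobLattice R).
Local Notation G := (Gam D).
Local Notation x := (xi D).
Local Notation q := (fl_q D).
Local Notation T := (tate D).
Implicit Types a b : T.

Lemma tseqE a n g : tseq a n g -> tseq a n = coset D n g.
Proof. by have [h _ ->] := tate_rep a n => /coset_eq->. Qed.

Lemma tseqG a n g : tseq a n g -> G g.
Proof.
have [h Gh ->] := tate_rep a n => -[k Gk ->].
by apply: GamD => //; exact: GamX.
Qed.

Lemma tseq_ex a n : exists g, tseq a n g.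
Proof. by have [g _ ->] := tate_rep a n; exists g; exact: coset_refl. Qed.

Lemma tseq_diff a n g h : tseq a n g -> tseq a n h ->
  exists2 k, G k & h = g + x ^+ n * k.
Proof. by move=> /tseqE->. Qed.

Lemma tseq_tr a n g k : tseq a n g -> G k -> tseq a n (g + x ^+ n * k).
Proof. by move=> /tseqE-> Gk; exists k. Qed.

Lemma tseq0P a n g : tseq a n 0 -> tseq a n g -> exists2 k, G k & g = x ^+ n * k.
Proof. by move=> a0 /(tseq_diff a0)[k Gk ->]; exists k; rewrite ?add0r. Qed.

Lemma tseq0I a n k : G k -> tseq a n (x ^+ n * k) -> tseq a n 0.
Proof.
by move=> Gk /tseq_tr/(_ (GamN Gk)); rewrite mulrN subrr.
Qed.

Lemma tseq_level0 a : tseq a 0 0.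
Proof.
have [g ag] := tseq_ex a 0; rewrite -(subrr g) -[X in g - X](mul1r g) -mulrN.
by rewrite -(expr0 x); apply: tseq_tr => //; exact/GamN/(tseqG ag).
Qed.

Lemma tseqS a n g : tseq a n.+1 g -> tseq a n g.
Proof. by have [_] := tseqP a n; exact. Qed.

Lemma tseq_le m n a g : (m <= n)%N -> tseq a n g -> tseq a m g.
Proof.
elim: n => [|n ih]; first by rewrite leqn0 => /eqP->.
by rewrite leq_eqVlt => /orP[/eqP->//|/ih h /tseqS].
Qed.

Lemma tate_eqP a b : (forall n, exists2 g, tseq a n g & tseq b n g) -> a = b.
Proof. by move=> h; apply: tate_ext => n; have [g /tseqE-> /tseqE->] := h n. Qed.

Lemma tseq00 n : tseq (0 : T) n 0.
Proof. exact: coset_refl. Qed.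

Lemma tseqD a b n g h : tseq a n g -> tseq b n h -> tseq (a + b) n (g + h).
Proof. by move=> ag bh; exists g => //; exists h. Qed.

Lemma tseqN a n g : tseq a n g -> tseq (- a) n (- g).
Proof. by move=> ag; exists g. Qed.

Lemma tseqB a b n g h : tseq a n g -> tseq b n h -> tseq (a - b) n (g - h).
Proof. by move=> ag bh; apply: tseqD => //; exact: tseqN. Qed.

Lemma tseqMn a n g m : tseq a n g -> tseq (a *+ m) n (g *+ m).
Proof.
move=> ag; elim: m => [|m ih]; first exact: tseq00.
by rewrite !mulrS; exact: tseqD.
Qed.

Lemma tseqMz a n g (m : int) : tseq a n g -> tseq (a *~ m) n (g *~ m).
Proof. by move=> ag; case: m => m; [exact: tseqMn|exact/tseqN/tseqMn]. Qed.

Lemma tseq_xi a n g : tseq a n g -> tseq (tate_xi a) n (x * g).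
Proof.
move=> ag; exists (x * g); first by exists g.
by exists 0; [exact: coset_refl|rewrite addr0].
Qed.

Lemma tseq_xiX a n g m : tseq a n g -> tseq (iter m (@tate_xi R D) a) n (x ^+ m * g).
Proof.
move=> ag; elim: m => [|m ih]; first by rewrite mul1r.
by rewrite iterS exprS -mulrA; exact: tseq_xi.
Qed.

Lemma tseq_of n g : G g -> tseq (tate_of D g) n g.
Proof. by rewrite /tate_of; case: pselect => // Gg _; exact: coset_refl. Qed.

Lemma tate_mk (c : nat -> R[i]) : (forall n, G (c n)) ->
  (forall n, exists2 k, G k & c n.+1 = c n + x ^+ n * k) ->
  exists a, forall n, tseq a n (c n).
Proof.
move=> Gc cS; have ch : coherent D (fun n => coset D n (c n)).
  move=> n; split; first by exists (c n).
  have [k Gk ck] := cS n; rewrite -(@coset_eq _ _ n (c n) (c n.+1)); last by exists k.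
  exact: cosetS.
by exists (Tate ch) => n; exact: coset_refl.
Qed.

Lemma tate_xiD a b : tate_xi (a + b) = tate_xi a + tate_xi b.
Proof.
apply: tate_eqP => n; have [g ag] := tseq_ex a n; have [h bh] := tseq_ex b n.
exists (x * g + x * h); last by apply: tseqD; exact: tseq_xi.
by rewrite -mulrDr; apply/tseq_xi/tseqD.
Qed.

Lemma tate_xiMn a m : tate_xi (a *+ m) = tate_xi a *+ m.
Proof.
apply: tate_eqP => n; have [g ag] := tseq_ex a n.
exists (x * g *+ m); last exact/tseqMn/tseq_xi.
by rewrite -mulrnAr; apply/tseq_xi/tseqMn.
Qed.

Lemma tate_xi0 : tate_xi (0 : T) = 0.
Proof. exact: (tate_xiMn 0 0). Qed.

Lemma tate_xiXMn N a m : iter N (@tate_xi R D) (a *+ m) = iter N (@tate_xi R D) a *+ m.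
Proof. by elim: N => //= N ->; rewrite tate_xiMn. Qed.

Lemma tate_xi_im n b : tseq b n.+1 0 -> exists2 a, tseq a n 0 & tate_xi a = b.
Proof.
move=> bn; have b1 : tseq b 1 0 by apply: tseq_le bn.
(* Dividing by xi loses one level, so level m of the quotient is read from level m + 1 of [b]. *)
have /choice[c hc] : forall m, exists c, G c /\ tseq b m.+1 (x * c).
  move=> m; have [g bg] := tseq_ex b m.+1.
  have [k Gk e] := tseq0P b1 (tseq_le (ltn0Sn m) bg).
  by exists k; rewrite -(expr1 x) -e.
have [m|m|a ac] := tate_mk (c := c); first by case: (hc m).
  have [k Gk e] := tseq_diff (hc m).2 (tseqS (hc m.+1).2).
  exists k => //; apply: (mulfI (xi_neq0 D)).
  by rewrite e exprS mulrDr mulrA.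
exists a; last first.
  by apply: tate_eqP => m; exists (x * c m); [exact: tseq_xi|exact/tseqS/(hc m).2].
have [k Gk e] := tseq0P bn (hc n).2.
apply: (tseq0I Gk); suff <- : c n = x ^+ n * k by [].
by apply: (mulfI (xi_neq0 D)); rewrite e exprS mulrA.
Qed.

Lemma tate_xi_T n a : tseq a n 0 -> tseq (tate_xi a) n.+1 0.
Proof.
move=> an; have [g ag] := tseq_ex a n.+1; have [k Gk e] := tseq0P an (tseqS ag).
by apply: (tseq0I Gk); rewrite exprS -mulrA -e; exact: tseq_xi.
Qed.

Lemma tate_xi_Tinv n a : tseq (tate_xi a) n.+1 0 -> tseq a n 0.
Proof.
move=> an; have [g ag] := tseq_ex a n.+1.
have [k Gk e] := tseq0P an (tseq_xi ag).
apply: (tseq0I Gk); suff <- : g = x ^+ n * k by exact: tseqS.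
by apply: (mulfI (xi_neq0 D)); rewrite e exprS mulrA.
Qed.

Lemma tate0P a : (forall n, tseq a n 0) -> a = 0.
Proof. by move=> h; apply: tate_eqP => n; exists 0 => //; exact: tseq00. Qed.

Lemma tate_xiI a : tate_xi a = 0 -> a = 0.
Proof.
by move=> e; apply: tate0P => n; apply: tate_xi_Tinv; rewrite e; exact: tseq00.
Qed.

Lemma tate_xiX_T N n a : tseq a n 0 -> tseq (iter N (@tate_xi R D) a) (N + n) 0.
Proof. by move=> an; elim: N => // N ih; rewrite iterS addSn; exact: tate_xi_T. Qed.

Lemma tate_xiX_im N n b : tseq b (N + n) 0 ->
  exists2 a, tseq a n 0 & iter N (@tate_xi R D) a = b.
Proof.
elim: N b => [|N ih] b; first by exists b.
rewrite addSn => /tate_xi_im[c /ih[a an <-] <-].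
by exists a.
Qed.

Lemma tate_xiXI N a : iter N (@tate_xi R D) a = 0 -> a = 0.
Proof. by elim: N => // N ih /= /tate_xiI. Qed.

(** * Inverting 1 - xi^(K+1) on T Gamma *)

Lemma geometric (K n : nat) (g : R[i]) : G g ->
  G (\sum_(j < n) x ^+ (K * j) * g).
Proof.
move=> Gg; elim/big_rec: _ => [|i y _ Gy]; first exact: Gam0.
by apply: GamD => //; exact: GamX.
Qed.

Lemma geometricE (K n : nat) (g : R[i]) :
  (\sum_(j < n) x ^+ (K * j) * g) - x ^+ K * (\sum_(j < n) x ^+ (K * j) * g)
  = g - x ^+ (K * n) * g.
Proof.
rewrite -mulr_suml; under eq_bigr do rewrite exprM.
have := subrX1 (x ^+ K) n; rewrite -exprM => e.
transitivity (- ((x ^+ K - 1) * (\sum_(j < n) (x ^+ K) ^+ j)) * g); first by ring.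
by rewrite -e; ring.
Qed.

(* The preimage is the sum of the series of the xi^((K+1) j) b. *)
Lemma tate_geo_surj K b : exists a, a - iter K.+1 (@tate_xi R D) a = b.
Proof.
have /choice[g bg] := tseq_ex b.
have Gg n := tseqG (bg n).
(* At level n the first n terms suffice: the later ones are multiples of xi^((K+1) n), hence of
   xi^n. *)
have [n|n|a ac] := tate_mk (c := fun n => \sum_(j < n) x ^+ (K.+1 * j) * g n).
- exact: geometric.
- have [k Gk ->] := tseq_diff (bg n) (tseqS (bg n.+1)).
  (* Passing from n to n + 1 changes the representative by xi^n k in every term and adds the term j
     = n; both changes are divisible by xi^n. *)
  exists (\sum_(j < n.+1) x ^+ (K.+1 * j) * k + x ^+ (K * n) * g n).
    by apply: GamD; [exact: geometric|exact: GamX].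
  under eq_bigr do rewrite mulrDr.
  rewrite big_split/= big_ord_recr/= -addrA; congr (_ + _).
  rewrite mulrDr addrC; congr (_ + _).
    by rewrite mulr_sumr; apply: eq_bigr => j _; rewrite mulrCA.
  by rewrite mulrA -exprD mulSn.
exists a; apply: tate_eqP => n.
exists (g n - x ^+ (K.+1 * n) * g n).
  by rewrite -geometricE; apply: tseqB => //; exact: tseq_xiX.
have -> : g n - x ^+ (K.+1 * n) * g n = g n + x ^+ n * - (x ^+ (K * n) * g n).
  by rewrite mulrN mulrA -exprD mulSn.
by apply: tseq_tr => //; apply/GamN/GamX.
Qed.

(** The inverse of 1 - xi^(K+1) is a power series in xi and so preserves levels: multiplying by its
    truncation recovers the representative [g] up to xi^((K+1) n) g. *)
Lemma tate_geo_T K n a : tseq (a - iter K.+1 (@tate_xi R D) a) n 0 -> tseq a n 0.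
Proof.
move=> h; have [g ag] := tseq_ex a n; have Gg := tseqG ag.
have [k Gk e] := tseq0P h (tseqB ag (tseq_xiX K.+1 ag)).
have := geometricE K.+1 n g; rewrite -mulr_suml mulrCA -mulrBr e => e2.
have {}e2 : g = x ^+ n * (\sum_(j < n) x ^+ (K.+1 * j) * k + x ^+ (K * n) * g).
  rewrite mulrDr mulrA -exprD -mulSn -mulr_suml mulrCA e2; ring.
rewrite e2 in ag; apply: tseq0I ag.
by apply: GamD; [exact: geometric|exact: GamX].
Qed.

Lemma tate_xi_pow_mod (m : nat) : exists (N k : nat) (c d : int), forall a,
  iter N (@tate_xi R D) (a - iter k.+1 (@tate_xi R D) a) =
  (a *~ c + tate_xi a *~ d) *+ m.+1.
Proof.
have [N [k [c [d E]]]] := xi_pow_mod D m; exists N, k, c, d => a.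
apply: tate_eqP => n; have [g ag] := tseq_ex a n.
exists (x ^+ N * (g - x ^+ k.+1 * g)); first by apply/tseq_xiX/tseqB => //; exact: tseq_xiX.
have -> : x ^+ N * (g - x ^+ k.+1 * g) = (g *~ c + x * g *~ d) *+ m.+1.
  rewrite mulrBr mulrA -exprD -mulrBl E -[RHS]mulr_natl -(mulrzl g) -(mulrzl (x * g)); ring.
by apply/tseqMn/tseqD; apply: tseqMz => //; exact: tseq_xi.
Qed.

(** If (m+1) a = 0 then xi^N (1 - xi^(k+1)) a = 0, and both factors are injective on T Gamma. *)
Lemma tate_torsion_free m a : a *+ m.+1 = 0 -> a = 0.
Proof.
move=> am; have [N [k [c [d h]]]] := tate_xi_pow_mod m.
suff e : a - iter k.+1 (@tate_xi R D) a = 0.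
  by apply: tate0P => n; apply: (@tate_geo_T k); rewrite e; exact: tseq00.
apply: (@tate_xiXI N); rewrite h mulrnDl !pmulrn (mulrzAC _ _ a) (mulrzAC _ _ (tate_xi a)).
rewrite -!pmulrn -tate_xiMn am !mul0rz add0r.
by rewrite tate_xi0 mul0rz.
Qed.

(** An element of xi^(N+n) T Gamma can be written xi^n xi^N (1 - xi^(k+1)) e, since 1 - xi^(k+1) is
    onto, and xi^N (1 - xi^(k+1)) is m + 1 times an element of Z[xi]. *)
Lemma tate_div m : exists N, forall n a, tseq a (N + n) 0 ->
  exists2 b, tseq b n 0 & a = b *+ m.+1.
Proof.
have [N [k [c [d h]]]] := tate_xi_pow_mod m; exists N => n a.
rewrite addnC => /tate_xiX_im[a' aN <-].
rewrite -[N]addn0 in aN; have [a'' _ <-] := tate_xiX_im aN.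
have [e <-] := tate_geo_surj k a''.
exists (iter n (@tate_xi R D) (e *~ c + tate_xi e *~ d)).
  by rewrite -[n in tseq _ n _]addn0; apply: tate_xiX_T; exact: tseq_level0.
by rewrite h tate_xiXMn.
Qed.

(** Multiplication by xi^n carries the cosets of xi Gamma in Gamma to level n, so one list of q
    representatives serves all levels. Both the compactness of T Gamma and the ratio of Haar
    measures of successive levels use it. *)
Lemma tate_split : exists c : 'I_q -> R[i],
  [/\ forall i, G (c i),
   forall n a, tseq a n 0 ->
     exists i, tseq (a - tate_of D (x ^+ n * c i)) n.+1 0 &
   forall n i j, tseq (tate_of D (x ^+ n * c i) - tate_of D (x ^+ n * c j)) n.+1 0 ->
     i = j].
Proof.
have [c [Gc cP cI']] := Gam_cosets D; exists c; split => //.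
  move=> n a an; have [g ag] := tseq_ex a n.+1.
  have [k Gk e] := tseq0P an (tseqS ag).
  have [i [h Gh ke]] := cP k Gk; exists i; apply: (tseq0I Gh).
  have -> : x ^+ n.+1 * h = g - x ^+ n * c i by rewrite e ke exprSr; ring.
  by apply: tseqB => //; apply/tseq_of/GamX.
move=> n i j h.
have [k Gk e] := tseq0P h (tseqB (tseq_of n.+1 (GamX n (Gc i)))
  (tseq_of n.+1 (GamX n (Gc j)))).
apply: (cI' _ _ k Gk); apply: (mulfI (expf_neq0 n (xi_neq0 D))).
by rewrite mulrDr mulrA -exprSr -e; ring.
Qed.

End Tate.

(** * The space V_xi Gamma *)

Section TensorQ.
Variable A : zmodType.
Implicit Types (a b : A) (u : tensorQ A).

Lemma QdivD a b m n :
  Qdiv a m + Qdiv b n = Qdiv (a *+ n.+1 + b *+ m.+1) (m.+1 * n.+1).-1.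
Proof. exact: Qadd_div. Qed.

Lemma Qdiv0 m : Qdiv (0 : A) m = 0.
Proof. by apply: (@Qdiv_eq _ _ _ _ _ 0%N); rewrite !mul0rn. Qed.

Lemma QdivN a m : Qdiv (- a) m = - Qdiv a m.
Proof. by rewrite [RHS]Qopp_div. Qed.

Lemma Qdiv_addl a b m : Qdiv (a + b) m = Qdiv a m + Qdiv b m.
Proof.
rewrite QdivD -mulrnDl; apply: (@Qdiv_eq _ _ _ _ _ 0%N).
by rewrite prednK ?muln_gt0// -mulrnA !muln1.
Qed.

Lemma QdivMn a m k : Qdiv (a *+ k) m = Qdiv a m *+ k.
Proof.
elim: k => [|k ih]; first by rewrite !mulr0n Qdiv0.
by rewrite !mulrS Qdiv_addl ih.
Qed.

Lemma QdivK a m : Qdiv a m *+ m.+1 = Qdiv a 0.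
Proof.
by rewrite -QdivMn; apply: (@Qdiv_eq _ _ _ _ _ 0%N); rewrite -mulrnA !muln1.
Qed.

Lemma tensorQ_torsion_free u m : u *+ m.+1 = 0 -> u = 0.
Proof.
rewrite (QdivP u) -QdivMn -[in X in _ = X -> _](Qdiv0 0) => /Qdiv_eqP[k].
rewrite mul0rn mul1n -mulrnA => e; rewrite -(Qdiv0 0).
by apply: (@Qdiv_eq _ _ _ _ _ (m.+1 * k.+1).-1); rewrite prednK// mul0rn mul1n.
Qed.

Lemma Qmap_div (B : zmodType) (f : A -> B) a m : (forall c k, f (c *+ k) = f c *+ k) ->
  Qmap f (Qdiv a m) = Qdiv (f a) m.
Proof.
move=> fM; rewrite /Qmap; have /Qdiv_eqP[k e] := QdivP (Qdiv a m).
by apply/esym/(@Qdiv_eq _ _ _ _ _ k); rewrite -!fM e.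
Qed.

End TensorQ.

Section Vxi.
Context {R : realType} (D : frobLattice R).
Local Notation G := (Gam D).
Local Notation x := (xi D).
Local Notation q := (fl_q D).
Local Notation T := (tate D).
Local Notation V := (Vxi D).
Local Notation U := (@Vxi_nbhd R D).
Implicit Types (a b : T) (u v w k : V).

Lemma Vxi_ofD a b : Vxi_of (a + b) = Vxi_of a + Vxi_of b.
Proof. exact: Qdiv_addl. Qed.

Lemma Vxi_ofN a : Vxi_of (- a) = - Vxi_of a.
Proof. exact: QdivN. Qed.

Lemma Vxi_ofB a b : Vxi_of (a - b) = Vxi_of a - Vxi_of b.
Proof. by rewrite Vxi_ofD Vxi_ofN. Qed.

Lemma Vxi_ofMn a m : Vxi_of (a *+ m) = Vxi_of a *+ m.
Proof. exact: QdivMn. Qed.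

Lemma Vxi_of0P a : Vxi_of a = 0 -> a = 0.
Proof.
move=> /Qdiv_eqP[k]; rewrite mul0rn mul1n; exact: tate_torsion_free.
Qed.

Lemma Vxi_ofI : injective (@Vxi_of R D).
Proof.
by move=> a b e; apply/eqP; rewrite -subr_eq0; apply/eqP/Vxi_of0P; rewrite Vxi_ofB e subrr.
Qed.

Lemma VxiP w : exists a m, w *+ m.+1 = Vxi_of a.
Proof. by exists (repr w).1, (repr w).2; rewrite {1}(QdivP w) QdivK. Qed.

Lemma Vxi_divP a m : exists w, w *+ m.+1 = Vxi_of a.
Proof. by exists (Qdiv a m); rewrite QdivK. Qed.

Lemma Vxi_mulnI w w' m : w *+ m.+1 = w' *+ m.+1 -> w = w'.
Proof.
move=> e; apply/eqP; rewrite -subr_eq0; apply/eqP/(@tensorQ_torsion_free _ _ m).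
by rewrite mulrnBl e subrr.
Qed.

Lemma Vxi_mul_div a m : Vxi_mul (Qdiv a m) = Qdiv (tate_xi a) m.
Proof. by apply: Qmap_div => c k; exact: tate_xiMn. Qed.

Lemma Vxi_mul_of a : Vxi_mul (Vxi_of a) = Vxi_of (tate_xi a).
Proof. exact: Vxi_mul_div. Qed.

Lemma Vxi_mulD u v : Vxi_mul (u + v) = Vxi_mul u + Vxi_mul v.
Proof.
rewrite (QdivP u) (QdivP v) QdivD !Vxi_mul_div QdivD.
by rewrite tate_xiD !tate_xiMn.
Qed.

Lemma Vxi_mulMn u m : Vxi_mul (u *+ m) = Vxi_mul u *+ m.
Proof.
elim: m => [|m ih]; last by rewrite !mulrS Vxi_mulD ih.
by apply: (@addrI _ (Vxi_mul 0)); rewrite -Vxi_mulD !mulr0n !addr0.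
Qed.

Lemma Vxi_mul0 : Vxi_mul (0 : V) = 0.
Proof. exact: (Vxi_mulMn 0 0). Qed.

Lemma Vxi_mulN u : Vxi_mul (- u) = - Vxi_mul u.
Proof. by apply: (@addrI _ (Vxi_mul u)); rewrite -Vxi_mulD !subrr Vxi_mul0. Qed.

Lemma Vxi_mulB u v : Vxi_mul (u - v) = Vxi_mul u - Vxi_mul v.
Proof. by rewrite Vxi_mulD Vxi_mulN. Qed.

Lemma Vxi_mulI : injective (@Vxi_mul R D).
Proof.
move=> u v e; apply/eqP; rewrite -subr_eq0; apply/eqP.
have {e} : Vxi_mul (u - v) = 0 by rewrite Vxi_mulB e subrr.
move: (u - v) => w e; have [a [m am]] := VxiP w.
apply: (@tensorQ_torsion_free _ _ m); rewrite am.
have /Vxi_of0P/tate_xiI -> : Vxi_of (tate_xi a) = 0.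
  by rewrite -Vxi_mul_of -am Vxi_mulMn e mul0rn.
exact: Qdiv0.
Qed.

(* q is a multiple of xi because xi is a root of X^2 - t X + q. *)
Lemma tate_q_im a : exists b, tate_xi b = a *+ q.
Proof.
have [_ [_ [m [_ [_ [n [_ _ _ _ [_ x2]]]]]]]] := frob_matrix D.
exists (a *~ (m + n) - tate_xi a); apply: tate_eqP => N.
have [g ag] := tseq_ex a N; exists (x * (g *~ (m + n) - x * g)).
  by apply/tseq_xi/tseqB; [exact: tseqMz|exact: tseq_xi].
suff -> : x * (g *~ (m + n) - x * g) = g *+ q by exact: tseqMn.
rewrite -mulrzl -mulr_natl.
by have -> : (q%:R : R[i]) = (m + n)%:~R * x - x ^+ 2; [rewrite x2|]; ring.
Qed.

Lemma Vxi_mul_surj w : exists u, Vxi_mul u = w.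
Proof.
have [a [m am]] := VxiP w; have [b ba] := tate_q_im a.
have q0 : (0 < m.+1 * q)%N by rewrite muln_gt0/= ltnW// fl_q_gt1.
(* From xi b = q a and a = (m+1) w, the preimage of w is b / ((m+1) q); the predecessor appears
   because [Qdiv] stores the denominator minus one. *)
have [u ub] := Vxi_divP b (m.+1 * q).-1; exists u.
apply: (@Vxi_mulnI _ _ (m.+1 * q).-1).
rewrite -Vxi_mulMn ub Vxi_mul_of ba prednK// mulrnA am.
by rewrite Vxi_ofMn.
Qed.

Lemma Vxi_invK w : Vxi_mul (Vxi_inv w) = w.
Proof. exact: (xgetPex 0 (Vxi_mul_surj w)). Qed.

Lemma Vxi_mulK u : Vxi_inv (Vxi_mul u) = u.
Proof. by apply: Vxi_mulI; rewrite Vxi_invK. Qed.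

Lemma Vxi_invD u v : Vxi_inv (u + v) = Vxi_inv u + Vxi_inv v.
Proof. by apply: Vxi_mulI; rewrite Vxi_mulD !Vxi_invK. Qed.

(** The linear part of [mapV]: differences of values of [mapV] are values of [xiV1] on differences,
    so bijectivity and the effect on cosets are settled on this additive map. *)
Definition xiV1 w := Vxi_inv w - w.

Lemma xiV1_mul u : xiV1 (Vxi_mul u) = u - Vxi_mul u.
Proof. by rewrite /xiV1 Vxi_mulK. Qed.

Lemma Vxi_sub1B u v :
  (u - v) - Vxi_mul (u - v) = (u - Vxi_mul u) - (v - Vxi_mul v).
Proof. by rewrite Vxi_mulB !opprB [X in _ + X]addrC addrACA [- v + _]addrC. Qed.

Lemma Vxi_sub1I u : u - Vxi_mul u = 0 -> u = 0.
Proof.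
move=> e; have [a [m am]] := VxiP u.
apply: (@tensorQ_torsion_free _ _ m); rewrite am.
have h : a - tate_xi a = 0.
  by apply: Vxi_of0P; rewrite Vxi_ofB -Vxi_mul_of -am Vxi_mulMn -mulrnBl e mul0rn.
rewrite (_ : a = 0); first exact: Qdiv0.
by apply: tate0P => n; apply: (@tate_geo_T _ _ 0); rewrite -[iter _ _ _]/(tate_xi a) h; exact: tseq00.
Qed.

Lemma Vxi_sub1_surj w : exists u, u - Vxi_mul u = w.
Proof.
have [a [m am]] := VxiP w; have [b ba] := tate_geo_surj 0 a.
have [u ub] := Vxi_divP b m; exists u; apply: (@Vxi_mulnI _ _ m).
by rewrite mulrnBl -Vxi_mulMn ub am -ba Vxi_ofB Vxi_mul_of.
Qed.

Lemma xiV1_surj w : exists u, xiV1 u = w.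
Proof. by have [u <-] := Vxi_sub1_surj w; exists (Vxi_mul u); rewrite xiV1_mul. Qed.

Lemma xiV1_inj0 u : xiV1 u = 0 -> u = 0.
Proof.
by rewrite -(Vxi_invK u) xiV1_mul => /Vxi_sub1I ->; rewrite Vxi_mul0.
Qed.

Lemma Vxi_nbhdP n a : U n (Vxi_of a) <-> tseq a n 0.
Proof. by split => [[b bn /Vxi_ofI <-//]|an]; exists a. Qed.

Lemma xiV1_nbhd n w : U n (xiV1 w) <-> U n.+1 w.
Proof.
split.
  rewrite -(Vxi_invK w) xiV1_mul; move: (Vxi_inv w) => u [a an e].
  (* That [u] comes from T Gamma follows from uniqueness: (1 - xi) b = a has a solution in T Gamma,
     and 1 - xi is injective on the whole of V_xi Gamma. *)
  have [b ba] := tate_geo_surj 0 a.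
  have bn : tseq b n 0 by apply: (@tate_geo_T _ _ 0); rewrite ba.
  suff -> : u = Vxi_of b by rewrite Vxi_mul_of; exact/Vxi_nbhdP/tate_xi_T.
  apply/eqP; rewrite -subr_eq0; apply/eqP/Vxi_sub1I.
  by rewrite Vxi_sub1B -e Vxi_mul_of -Vxi_ofB ba subrr.
move=> [a an <-]; have [b bn <-] := tate_xi_im an.
rewrite -Vxi_mul_of xiV1_mul Vxi_mul_of -Vxi_ofB; apply/Vxi_nbhdP.
by rewrite -(subr0 0); apply: tseqB => //; exact/tseqS/tate_xi_T.
Qed.

Lemma Vxi_nbhd0 n : U n 0.
Proof. by exists 0; [exact: tseq00|exact: Qdiv0]. Qed.

Lemma Vxi_nbhdD n u v : U n u -> U n v -> U n (u + v).
Proof.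
move=> [a an <-] [b bn <-]; rewrite -Vxi_ofD; apply/Vxi_nbhdP.
by rewrite -(addr0 0); exact: tseqD.
Qed.

Lemma Vxi_nbhdN n u : U n u -> U n (- u).
Proof.
by move=> [a an <-]; rewrite -Vxi_ofN; apply/Vxi_nbhdP; rewrite -oppr0; exact: tseqN.
Qed.

(** * The map [mapV] and the topology of V_xi Gamma *)

Variable gam : R[i].
Local Notation mapV := (@mapV R D gam).

Lemma mapVD w k : mapV (w + k) = mapV w + xiV1 k.
Proof.
by rewrite /Defs.mapV /xiV1 Vxi_invD opprD (addrAC (Vxi_inv w)) addrACA.
Qed.

Lemma mapV_bij : bijective mapV.
Proof.
have sj w : exists u, mapV u = w.
  have [u ue] := xiV1_surj (w - mapV 0); exists u.
  by rewrite -[u]add0r mapVD ue addrC subrK.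
have [g gK] := choice sj; exists g => // u.
apply/eqP; rewrite -subr_eq0; apply/eqP/xiV1_inj0.
by apply: (addrI (mapV u)); rewrite -mapVD addrC subrK gK addr0.
Qed.

(** The coset w + xi^n T Gamma. As for balls of an ultrametric, every point is a centre, and two of
    them that meet are nested. *)
Definition Vball n w : set V := [set y | U n (y - w)].

Lemma Vball_refl n w : Vball n w w.
Proof. by rewrite /Vball/= subrr; exact: Vxi_nbhd0. Qed.

Lemma Vball_eq n w y : Vball n w y -> Vball n y = Vball n w.
Proof.
move=> h; apply/seteqP; split=> z; rewrite /Vball/= => hz.
  by rewrite -(subrK y z) -addrA; exact: Vxi_nbhdD.
by rewrite -(subrK w z) -addrA -[w - y]opprB; apply: Vxi_nbhdD => //; exact: Vxi_nbhdN.
Qed.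

Lemma VballS m n w : (m <= n)%N -> Vball n w `<=` Vball m w.
Proof. by move=> mn y; exact: Vxi_nbhdS. Qed.

Lemma VopenE (A : set V) : open A = Vxi_open A.
Proof. by []. Qed.

Lemma Vball_open n w : open (Vball n w).
Proof.
rewrite VopenE => y yw; exists n => k kn.
by rewrite /Vball/= addrAC; exact: Vxi_nbhdD.
Qed.

Lemma open_VballP (A : set V) : open A <-> forall w, A w -> exists n, Vball n w `<=` A.
Proof.
rewrite VopenE; split=> oA w Aw; have [n h] := oA w Aw; exists n.
  by move=> y yw; rewrite -(subrK w y) addrC; exact: h.
by move=> k kn; apply: h; rewrite /Vball/= addrC addKr.
Qed.

Lemma nbhs_VballP (A : set V) w : nbhs w A <-> exists n, Vball n w `<=` A.
Proof.
split=> [|[n h]].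
  rewrite nbhsE/= => -[B [oB Bw] BA]; have [n h] := (open_VballP B).1 oB w Bw.
  by exists n; exact: subset_trans BA.
apply: filterS h _; apply: open_nbhs_nbhs; split; first exact: Vball_open.
exact: Vball_refl.
Qed.

Lemma mapVB y w : mapV y - mapV w = xiV1 (y - w).
Proof.
by have := mapVD w (y - w); rewrite addrC subrK => ->; rewrite addrC addKr.
Qed.

Lemma mapV_Vball n w : mapV @^-1` Vball n (mapV w) = Vball n.+1 w.
Proof.
by apply/seteqP; split=> y; rewrite /Vball/= mapVB xiV1_nbhd.
Qed.

(** The countable set is the image of Gamma (x) Q. To approximate w = a / (m+1) to level n, [a] is
    replaced by a lattice element up to level N + n, with N the loss of level caused by dividing by
    m + 1. *)
Lemma Vxi_dense : exists e : nat -> V, forall n w, exists i, Vball n (e i) w.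
Proof.
have [w1 [w2 [_ [_ [_ [_ [_ GE _ _ _]]]]]]] := frob_matrix D.
pose f (p : int * int * nat) : V :=
  Qdiv (tate_of D (p.1.1%:~R * w1 + p.1.2%:~R * w2)) p.2.
exists (fun i => if unpickle i is Some p then f p else 0) => n w.
have [a [m am]] := VxiP w; have [N hN] := tate_div D m.
have [g ag] := tseq_ex a (N + n); have Gg := tseqG ag.
have [|b bn e] := hN n (a - tate_of D g).
  by rewrite -(subrr g); apply: tseqB => //; exact: tseq_of.
have : G g by []; rewrite {1}GE => -[i [j gE]].
exists (pickle (i, j, m)); rewrite /Vball/= pickleK /f/= -gE.
suff -> : w - Qdiv (tate_of D g) m = Vxi_of b by exact/Vxi_nbhdP.
by apply: (@Vxi_mulnI _ _ m); rewrite mulrnBl QdivK am -Vxi_ofMn -e Vxi_ofB.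
Qed.

Lemma open_bigcup_Vball (A : set V) (e : nat -> V) :
  (forall n w, exists i, Vball n (e i) w) -> open A ->
  A = \bigcup_(p in [set p : nat * nat | Vball p.1.+1 (e p.2) `<=` A])
        Vball p.1.+1 (e p.2).
Proof.
move=> de oA; apply/seteqP; split=> [w Aw|w [p pA]]; last exact: pA.
have [n h] := (open_VballP A).1 oA w Aw; have [i wi] := de n.+1 w.
exists (n, i) => //=; rewrite -(Vball_eq wi).
by apply: subset_trans h; exact: VballS.
Qed.

(** An ultrafilter containing a coset of level n contains one of its q subcosets of level n + 1. The
    nested cosets so chosen define an element of T Gamma, to which the ultrafilter converges. *)
Lemma Vball0_compact : compact (Vball 0 0).
Proof.
have [c [Gc cP _]] := tate_split D.
rewrite compact_ultra => F FU FA.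
have st n (a : T) : F (Vball n (Vxi_of a)) ->
    exists b, F (Vball n.+1 (Vxi_of b)) /\ Vball n (Vxi_of a) (Vxi_of b).
  move=> Fa; pose B i := Vball n.+1 (Vxi_of (a + tate_of D (x ^+ n * c i))).
  apply: contrapT => nb.
  have Fn i : F (~` B i).
    have [FB|//] := in_ultra_setVsetC (B i) FU.
    exfalso; apply: nb; exists (a + tate_of D (x ^+ n * c i)); split => //.
    rewrite /Vball/= -Vxi_ofB addrAC subrr add0r; apply/Vxi_nbhdP.
    apply: (@tseq0I _ _ _ _ (c i)) => //; exact/tseq_of/GamX.
  have [y [ya yB]] := filter_ex (filterI Fa (@filter_forall _ _ _ F _ Fn)).
  move: ya => [b bn e]; have [i hi] := cP n b bn.
  apply: (yB i); rewrite /B /Vball/= Vxi_ofD opprD addrA -e -Vxi_ofB.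
  exact/Vxi_nbhdP.
have /choice[g gP] : forall p : nat * T, exists b, F (Vball p.1 (Vxi_of p.2)) ->
    F (Vball p.1.+1 (Vxi_of b)) /\ Vball p.1 (Vxi_of p.2) (Vxi_of b).
  move=> [n a]; have [h|h] := pselect (F (Vball n (Vxi_of a))).
    by have [b hb] := st n a h; exists b.
  by exists a.
pose s := fix s n := if n is m.+1 then g (m, s m) else 0.
have Fs n : F (Vball n (Vxi_of (s n))).
  elim: n => [|n ih]; first by rewrite /= -[Vxi_of 0]/(Qdiv 0 0) Qdiv0.
  by have [] := gP (n, s n) ih.
have ss n : tseq (s n.+1 - s n) n 0.
  by have [_] := gP (n, s n) (Fs n); rewrite /Vball/= -Vxi_ofB => /Vxi_nbhdP.
(* Only level n of the n-th centre is stable from then on, so the limit takes its n-th component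
   from [s n]. *)
have [r rP] := @choice nat R[i] (fun n g => tseq (s n) n g)
  (fun n => tseq_ex (s n) n).
have [n|n|a ar] := @tate_mk _ D r; [exact: tseqG (rP n)| |].
  have [k Gk e] := tseq0P (ss n) (tseqB (tseqS (rP n.+1)) (rP n)).
  by exists k => //; rewrite -e addrC subrK.
exists (Vxi_of a); split.
  by rewrite /Vball/= subr0; apply/Vxi_nbhdP; exact: tseq_level0.
move=> A /nbhs_VballP[n h]; apply: filterS (Fs n); rewrite -(@Vball_eq n _ (Vxi_of a))//.
rewrite /Vball/= -Vxi_ofB; apply/Vxi_nbhdP; rewrite -(subrr (r n)).
exact: tseqB.
Qed.

End Vxi.

(** * Haar measure on V_xi Gamma *)

Section Haar.
Context {R : realType} (D : frobLattice R).
Local Notation G := (Gam D).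
Local Notation x := (xi D).
Local Notation q := (fl_q D).
Local Notation T := (tate D).
Local Notation V := (Vxi D).
Local Notation U := (@Vxi_nbhd R D).
Local Notation bV := (borelVxi D).

Lemma open_measurableV (A : set V) : open A -> measurable (A : set bV).
Proof. exact: sub_sigma_algebra. Qed.

Lemma measurable_Vball n w : measurable (Vball n w : set bV).
Proof. by apply: open_measurableV; exact: Vball_open. Qed.

(* T Gamma has countably many cosets, so the cosets of the subgroups xi^n T Gamma
   already generate the Borel sets. *)
Lemma measurableV_ball :
  @measurable _ bV = <<s [set A | A = set0 \/ exists n w, A = Vball n.+1 w] >>.
Proof.
apply/seteqP; split; last first.
  apply: smallest_sub; first exact: sigma_algebra_measurable.
  by move=> _ [->|[n [w ->]]]; [exact: measurable0|exact: measurable_Vball].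
apply: smallest_sub; first exact: smallest_sigma_algebra.
move=> A oA; have [e de] := Vxi_dense D.
set B := [set A | _].
rewrite (open_bigcup_Vball de oA) bigcup_mkcond.
apply: (@countable_bigcupT_measurable _ (g_sigma_algebraType B)) => // p.
case: ifP => _; last exact: measurable0.
by apply: sub_sigma_algebra; right; exists p.1, (e p.2).
Qed.

Variables (mu : {measure set bV -> \bar R}) (hmu : is_haar mu).

Lemma haar_Vball n w : mu (Vball n w) = mu (Vball n 0).
Proof.
have [tr _ _] := hmu; rewrite -(tr w (Vball n 0)); last exact: measurable_Vball.
congr (mu _); apply/seteqP; split=> y.
  move=> yw; exists (y - w); first by rewrite /Vball/= subr0.
  by rewrite addrC subrK.
move=> [k hk <-]; move: hk; rewrite /Vball/= subr0.
by rewrite [w + k]addrC addrK.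
Qed.

Lemma haar_Vball_fin n w : (mu (Vball n w) < +oo)%E.
Proof.
have [_ cf _] := hmu; rewrite haar_Vball.
apply: le_lt_trans (cf _ (@Vball0_compact _ D)).
apply: le_measure; rewrite ?inE; [exact: measurable_Vball..|].
exact: VballS.
Qed.

Lemma haar_VballS n : mu (Vball n 0) = (q%:R%:E * mu (Vball n.+1 0%R))%E.
Proof.
have [c [Gc cP cI']] := tate_split D.
pose v i := Vxi_of (tate_of D (x ^+ n * c i)) : V.
have -> : Vball n 0 = \big[setU/set0]_(i < q) Vball n.+1 (v i).
  rewrite -bigcup_seq.
  apply/seteqP; split=> y.
    rewrite /Vball/= subr0 => -[a an <-]; have [i hi] := cP n a an.
    exists i; first exact: mem_index_enum.
    by rewrite /Vball/= -Vxi_ofB; exact/Vxi_nbhdP.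
  move=> [i _] h; rewrite -(@Vball_eq _ _ n 0 (v i)).
    exact: (VballS (leqnSn n)) h.
  rewrite /Vball/= subr0; apply/Vxi_nbhdP; apply: (@tseq0I _ _ _ _ (c i)) => //.
  exact/tseq_of/GamX.
rewrite measure_bigsetU_ord//; last first.
- apply/trivIsetP => i j _ _ ij; apply/eqP/negPn/negP => /set0P[y [yi yj]].
  have : Vball n.+1 (v j) (v i) by rewrite -(Vball_eq yj) (Vball_eq yi); exact: Vball_refl.
  rewrite /Vball/= -Vxi_ofB => /Vxi_nbhdP/cI'/eqP.
  by rewrite (negbTE ij).
- by move=> i; exact: measurable_Vball.
transitivity (\sum_(i < q) mu (Vball n.+1 0%R))%E.
  by apply: eq_bigr => i _; exact: haar_Vball.
rewrite big_const_ord; elim: (q) => [|k ih]; first by rewrite mul0e.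
by rewrite iterS ih -natr1 EFinD ge0_muleDl ?lee_fin// mul1e addeC.
Qed.

(** * The effect of [mapV] on Haar measure *)

Variable gam : R[i].
Local Notation mapV := (@mapV R D gam).

Lemma mapV_open (A : set V) : open A -> open (mapV @^-1` A).
Proof.
rewrite open_VballP => oA; rewrite open_VballP => w /oA[n h]; exists n.+1.
by rewrite -(mapV_Vball gam) => y /h.
Qed.

Lemma mapV_open_image (A : set V) : open A -> open (mapV @` A).
Proof.
rewrite open_VballP => oA; rewrite open_VballP => _ [w Aw <-].
have [n h] := oA w Aw; exists n => z; have [g gK Kg] := mapV_bij D gam.
rewrite -(Kg z) => hz; exists (g z) => //; apply: h.
by apply: (VballS (leqnSn n)); rewrite -(mapV_Vball gam).
Qed.

Lemma measurable_openV (f : V -> V) : (forall A, open A -> open (f @^-1` A)) ->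
  measurable_fun [set: bV] (f : bV -> bV).
Proof.
move=> fo; apply: (@measurability _ _ bV bV _ _ (@open V)) => //.
move=> _ [B oB <-]; rewrite setTI; apply: open_measurableV; exact: fo.
Qed.

Lemma measurable_mapV : measurable_fun [set: bV] (mapV : bV -> bV).
Proof. by apply: measurable_openV; exact: mapV_open. Qed.

Lemma q_gt0 : (0 : R) < q%:R.
Proof. by rewrite ltr0n ltnW// fl_q_gt1. Qed.

(** Both sides are measures in A. With the empty set the cosets are stable under intersection,
    countably many of finite measure cover the space, and on a coset of level n the preimage has
    level n + 1, hence q times less mass. *)
Lemma haar_mapV (A : set bV) : measurable A ->
  mu (mapV @^-1` (A : set V)) = ((q%:R^-1)%:E * mu A)%E.
Proof.
have iq0 : (0 : R) <= q%:R^-1 by rewrite invr_ge0 ler0n.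
pose m1 : {measure set bV -> \bar R} := mscale (NngNum iq0) mu.
pose m2 : {measure set bV -> \bar R} := pushforward mu (mapV : bV -> bV).
have [e de] := Vxi_dense D.
move=> mA; apply/esym; rewrite -[LHS]/(m1 A) -[RHS]/(m2 measurable_mapV A).
apply: (measure_unique _ (fun i => Vball 1 (e i) : set bV) measurableV_ball) => //.
- move=> B1 B2 [->|[n [w ->]]]; first by rewrite set0I; left.
  move=> [->|[m [v ->]]]; first by rewrite setI0; left.
  have [->|/set0P[y [yw yv]]] := eqVneq (Vball n.+1 w `&` Vball m.+1 v) set0.
    by left.
  right; rewrite -(Vball_eq yw) -(Vball_eq yv); exists (maxn n m), y.
  have [nm|mn] := leqP n m.
    by apply: setIidr; exact: VballS.
  by apply: setIidl; apply: VballS; rewrite ltnS ltnW.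
- by move=> i; right; exists 0%N, (e i).
- by apply/seteqP; split => // w _; have [i wi] := de 1%N w; exists i.
- move=> _ [->|[n [w ->]]]; first by rewrite !measure0.
  have [g _ gK] := mapV_bij D gam; rewrite -(gK w).
  rewrite /m1 /m2 /= /mscale/= /pushforward mapV_Vball [LHS]/= (haar_Vball n.+1) (haar_Vball n.+2).
  rewrite (haar_VballS n.+1) muleA -EFinM mulVf ?mul1e// gt_eqF//.
  exact: q_gt0.
- move=> k; rewrite /m1 /= /mscale/=; apply: lte_mul_pinfty => //.
  exact: haar_Vball_fin.
Qed.

(** The scaling of preimages is applied to the image of A, which is Borel because the inverse of
    [mapV] is continuous. *)
Lemma jacobian_mapV : has_jacobianV mu mapV q%:R.
Proof.
move=> A mA; have [g gK Kg] := mapV_bij D gam.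
have imE (B : set V) : mapV @` B = g @^-1` B.
  apply/seteqP; split=> [_ [w Bw <-]|w Bw]; first by rewrite /preimage/= gK.
  by exists (g w).
have mg : measurable_fun [set: bV] (g : bV -> bV).
  by apply: measurable_openV => B oB; rewrite -imE; exact: mapV_open_image.
have mI : measurable (mapV @` (A : set V) : set bV).
  by rewrite imE -[X in measurable X]setTI; exact: mg.
have -> : A = mapV @^-1` (mapV @` (A : set V)).
  apply/seteqP; split=> w; first by exists w.
  by move=> [v Av /(can_inj gK) <-].
rewrite haar_mapV// muleA -EFinM divff ?mul1e.
  congr (mu _); apply/seteqP; split => w; first by move=> [v hv <-].
  by move=> [v Av <-]; exists v => //; exists v.
by rewrite gt_eqF//; exact: q_gt0.
Qed.

End Haar.

Lemma Rintegral_change_var d (X : measurableType d) (R : realType)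
    (m : {measure set X -> \bar R}) (phi : X -> X) (c : R) (f : X -> R) :
  measurable_fun setT phi -> 0 <= c ->
  (forall A, measurable A -> m (phi @^-1` A) = (c%:E * m A)%E) ->
  measurable_fun setT f -> (forall x, 0 <= f x) ->
  \int[m]_x f (phi x) = c * \int[m]_x f x.
Proof.
move=> mphi c0 cm mf f0; rewrite /Rintegral.
have -> : (\int[m]_y (f (phi y))%:E = c%:E * \int[m]_y (f y)%:E)%E.
  have fE0 y : setT y -> (0 <= (f y)%:E)%E by rewrite lee_fin.
  have /measurable_EFinP mfE := mf.
  rewrite -(ge0_integral_mscale m measurableT (NngNum c0) mfE)//.
  rewrite -[LHS](@ge0_integral_pushforward _ _ _ _ _ _ mphi m setT (EFin \o f))//; last first.
    by move=> y _; exact: fE0.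
  by apply: eq_measure_integral => A mA _; exact: cm.
(* [Rintegral] sends an infinite value to 0, so the equality persists when the integral diverges; c
   = 0 is apart because 0 times infinity is 0. *)
move: (\int[m]_y (f y)%:E)%E => -[r| |] //.
- have [->|c_neq0] := eqVneq c 0; first by rewrite mul0e mul0r.
  by rewrite gt0_muley ?lte_fin ?lt0r ?c_neq0// mulr0.
- have [->|c_neq0] := eqVneq c 0; first by rewrite mul0e mul0r.
  by rewrite gt0_muleNy ?lte_fin ?lt0r ?c_neq0// mulr0.
Qed.

(** * Similitudes of the plane *)

Section Plane.
Context {R : realType}.
Local Notation leb := (@lebesgue_measure R).
Local Notation leb2 := ((leb \x leb)%E).

Lemma measurable_affine (k l : R) : measurable_fun setT (fun y : R => k * y + l).
Proof. by apply: measurable_funD => //; exact: measurable_funM. Qed.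

Lemma lebesgue_affine (k l : R) (B : set R) : k != 0 -> measurable B ->
  leb ((fun y => k * y + l) @^-1` B) = ((`|k|^-1)%:E * leb B)%E.
Proof.
move=> k0 mB; have ak : 0 < `|k| by rewrite normr_gt0.
pose phi : measurableTypeR R -> measurableTypeR R := fun y => k * y + l.
have mphi : measurable_fun setT phi by exact: measurable_affine.
pose m' : {measure set (measurableTypeR R) -> \bar R} :=
  mscale (NngNum (ltW ak)) (pushforward leb phi).
suff e : leb B = (`|k|%:E * leb (phi @^-1` B))%E.
  by rewrite e muleA -EFinM mulVf ?mul1e// normr_eq0.
rewrite -[RHS]/(m' mphi B).
apply: lebesgue_measure_unique => //= _ [[a b]] /= ab <-.
rewrite /mscale/= /pushforward /phi.
have [kp|kn] := ltP 0 k.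
  have -> : (fun y => k * y + l) @^-1` `]a, b] = `](a - l) / k, (b - l) / k]%classic.
    by apply/seteqP; split=> y /=; rewrite !in_itv/= ltr_pdivrMr// ler_pdivlMr//
      ltrBlDr lerBrDr [y * k]mulrC.
  rewrite !lebesgue_measure_itv/= !lte_fin ltr_pM2r ?invr_gt0// ltrD2r.
  case: ifP => _; last by rewrite mule0.
  by rewrite -!EFinD -EFinM (gtr0_norm kp); congr EFin; field.
(* A negative slope reverses the interval and moves its closed end to the left, which leaves the
   measure unchanged. *)
have {}kn : k < 0 by rewrite lt_neqAle k0.
have -> : (fun y => k * y + l) @^-1` `]a, b] = `[(b - l) / k, (a - l) / k[%classic.
  apply/seteqP; split=> y /=; rewrite !in_itv/= ltr_ndivlMr// ler_ndivrMr//
      ltrBlDr lerBrDr [y * k]mulrC andbC//.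
rewrite !lebesgue_measure_itv/= !lte_fin ltr_nM2r ?invr_lt0// ltrD2r.
case: ifP => _; last by rewrite mule0.
by rewrite -!EFinD -EFinM (ltr0_norm kn); congr EFin; field.
Qed.

(** Preimages make both sides measures in A; [c] is therefore the inverse of the Jacobian. *)
Definition scales (phi : R * R -> R * R) (c : R) : Prop :=
  measurable_fun setT phi /\
  forall A, measurable A -> leb2 (phi @^-1` A) = (c%:E * leb2 A)%E.

Lemma scales_comp phi psi c d : scales phi c -> scales psi d ->
  scales (phi \o psi) (c * d).
Proof.
move=> [mphi hphi] [mpsi hpsi]; split; first exact: measurableT_comp.
move=> A mA; rewrite comp_preimage hpsi; last by rewrite -[X in measurable X]setTI; exact: mphi.
by rewrite hphi// muleA -EFinM mulrC.
Qed.

(** On each vertical line the map is affine of slope k, and the product measure is the integral of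
    the measures of these sections. *)
Lemma scales_shear (k : R) (l : R -> R) : k != 0 -> measurable_fun setT l ->
  scales (fun a => (a.1, k * a.2 + l a.1)) `|k|^-1.
Proof.
move=> k0 ml; split.
  apply: measurable_fun_pair => //; apply: measurable_funD.
    by apply: measurable_funM => //; exact: measurable_cst.
  exact: measurableT_comp.
move=> A mA; rewrite /product_measure1.
transitivity (\int[leb]_z (`|k|^-1%:E * (leb \o xsection A) z))%E.
  apply: eq_integral => z _ /=; rewrite -(lebesgue_affine (l z) k0).
    by congr (leb _); apply/seteqP; split=> y; rewrite /xsection/= !inE.
  exact: measurable_xsection.
rewrite ge0_integralZl//.
exact: measurable_fun_xsection.
Qed.

Lemma scales_swap : scales (fun a => (a.2, a.1)) 1.
Proof.
pose RR := (measurableTypeR R * measurableTypeR R)%type.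
pose phi : RR -> RR := fun a => (a.2, a.1).
have ms : measurable_fun setT phi by exact: measurable_fun_pair.
split=> // A mA; rewrite mul1e.
pose m' : {measure set RR -> \bar R} := pushforward leb2 phi.
rewrite -[LHS]/(m' ms A); apply/esym; apply: product_measure_unique => //.
move=> B C mB mC; rewrite /m' /= /pushforward.
rewrite (_ : _ @^-1` _ = C `*` B); last first.
  by apply/seteqP; split=> -[? ?] [].
by rewrite product_measure1E// muleC.
Qed.

Lemma scales_shearl (k : R) (l : R -> R) : k != 0 -> measurable_fun setT l ->
  scales (fun a => (k * a.1 + l a.2, a.2)) `|k|^-1.
Proof.
move=> k0 ml; rewrite -[`|k|^-1]mul1r -[X in scales _ X]mulr1.
exact: (scales_comp (scales_comp scales_swap (scales_shear k0 ml)) scales_swap).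
Qed.

Lemma scales_similitude (u v s t : R) : u ^+ 2 + v ^+ 2 != 0 ->
  scales (fun a => (u * a.1 - v * a.2 + s, v * a.1 + u * a.2 + t)) (u ^+ 2 + v ^+ 2)^-1.
Proof.
move=> uv0; have uvp : 0 < u ^+ 2 + v ^+ 2 by rewrite lt0r uv0 addr_ge0// sqr_ge0.
(* The triangular factorization of the matrix has u as pivot; for u = 0 the coordinates are swapped
   first. *)
have [u0|u0] := eqVneq u 0.
  have v0 : v != 0 by apply: contraNneq uv0 => ->; rewrite u0 expr0n/= addr0.
  have vn0 : - v != 0 by rewrite oppr_eq0.
  have := scales_comp (scales_comp (scales_shearl vn0 (measurable_cst s))
    (scales_shear v0 (measurable_cst t))) scales_swap.
  congr scales; first by apply/funext => -[a b] /=; rewrite u0 !mul0r add0r addr0 mulNr.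
  rewrite u0 expr0n/= add0r mulr1 normrN -invfM; congr (_^-1).
  by rewrite -expr2 real_normK ?num_real.
(* The second pivot: determinant u^2 + v^2 divided by the first pivot u. *)
have k0 : (u ^+ 2 + v ^+ 2) / u != 0 by rewrite mulf_neq0// invr_eq0.
have := scales_comp (scales_shear k0 (measurable_affine (v / u) (t - v / u * s)))
  (scales_shearl u0 (measurable_affine (- v) s)).
congr scales.
  by apply/funext => -[a b] /=; congr (_, _); [ring|field].
by rewrite normrM normfV (gtr0_norm uvp) invfM invrK mulfK ?normr_eq0//.
Qed.

End Plane.

(** * The Jacobian on C *)

Section JacobianC.
Context {R : realType} (D : frobLattice R).
Local Notation x := (xi D).
Local Notation leb := (@lebesgue_measure R).
Variable gam : R[i].
Local Notation mapC := (mapC D gam).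
Local Notation J := (complex.Re `|x^-1 - 1| ^+ 2).

Definition xiV_sub1 : R[i] := x^-1 - 1.

(** xi = 1 would force q = |xi|^2 = 1. *)
Lemma xiV_sub1_neq0 : xiV_sub1 != 0.
Proof.
rewrite /xiV_sub1 subr_eq0; apply/eqP => /(congr1 GRing.inv); rewrite invrK invr1 => x1.
have := xi_norm D; rewrite x1 normr1 expr1n => /esym/eqP.
by rewrite -/(fl_q D) -[1]/(1%:R) eqr_nat; have := fl_q_gt1 D; case: fl_q => [|[]].
Qed.

Lemma jacE : J = complex.Re xiV_sub1 ^+ 2 + complex.Im xiV_sub1 ^+ 2.
Proof. by rewrite -/xiV_sub1 normc_def /= sqr_sqrtr// addr_ge0// sqr_ge0. Qed.

Lemma jac_gt0 : 0 < J.
Proof.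
rewrite jacE lt0r addr_ge0 ?sqr_ge0// andbT paddr_eq0 ?sqr_ge0// !sqrf_eq0.
by have := xiV_sub1_neq0; rewrite eq_complex.
Qed.

Lemma mapCE z : mapC z = xiV_sub1 * z - gam.
Proof. by rewrite /Defs.mapC /xiV_sub1; ring. Qed.

Lemma mapC_bij : bijective mapC.
Proof.
exists (fun w => xiV_sub1^-1 * (w + gam)) => z; rewrite mapCE.
  by rewrite subrK mulKf// xiV_sub1_neq0.
by rewrite mulVKf ?xiV_sub1_neq0// addrK.
Qed.

Definition affC (c e : R[i]) (a : R * R) : R * R :=
  (complex.Re (c * (a.1 +i* a.2) + e), complex.Im (c * (a.1 +i* a.2) + e)).

Lemma affCK c e a : (affC c e a).1 +i* (affC c e a).2 = c * (a.1 +i* a.2) + e.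
Proof. by rewrite /affC/=; case: (_ + e). Qed.

Lemma scales_affC c e : c != 0 ->
  scales (affC c e) (complex.Re c ^+ 2 + complex.Im c ^+ 2)^-1.
Proof.
case: c e => [u v] [s t]; rewrite eq_complex/= => uv0.
have := scales_similitude (u := u) (v := v) s t.
rewrite paddr_eq0 ?sqr_ge0// !sqrf_eq0 => /(_ uv0); congr scales.
by apply/funext => -[a b]; rewrite /affC /=; congr (_, _); ring.
Qed.

Definition mapC2 := affC xiV_sub1 (- gam).

Lemma mapC2K a : (mapC2 a).1 +i* (mapC2 a).2 = mapC (a.1 +i* a.2).
Proof. by rewrite affCK mapCE. Qed.

Lemma scales_mapC2 : scales mapC2 J^-1.
Proof. by rewrite jacE; exact/scales_affC/xiV_sub1_neq0. Qed.

Lemma jacobian_mapC : has_jacobianC mapC J.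
Proof.
move=> A mA; rewrite /lebC; have [mphi sc] := scales_mapC2.
pose B := [set a : R * R | (mapC @` A) (a.1 +i* a.2)].
have BE : mapC2 @^-1` B = [set a | A (a.1 +i* a.2)].
  apply/seteqP; split=> a; rewrite /B /preimage /= mapC2K; last by exists (a.1 +i* a.2).
  by move=> [z Az /(bij_inj mapC_bij) <-].
have mB : measurable B.
  have [|mg _] := @scales_affC xiV_sub1^-1 (xiV_sub1^-1 * gam); first by rewrite invr_eq0 xiV_sub1_neq0.
  rewrite (_ : B = affC xiV_sub1^-1 (xiV_sub1^-1 * gam) @^-1` [set a | A (a.1 +i* a.2)]).
    by rewrite -[X in measurable X]setTI; exact: mg.
  apply/seteqP; split=> a; rewrite /B /preimage /= affCK.
    by move=> [z Az <-]; rewrite mapCE -mulrDr subrK mulKf ?xiV_sub1_neq0.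
  by move=> ?; eexists; first eassumption; rewrite mapCE -mulrDr mulVKf ?xiV_sub1_neq0// addrK.
rewrite -BE sc// muleA -EFinM divff ?mul1e//.
exact/lt0r_neq0/jac_gt0.
Qed.

End JacobianC.

(** * Measurability and comparison of integrals *)

Lemma continuous_pair2 (X Y Z : topologicalType) (f : X -> Y) (g : X -> Z) :
  continuous f -> continuous g -> continuous (fun x => (f x, g x)).
Proof.
by move=> cf cg x; apply: (@cvg_pair _ _ _ _ (nbhs (f x)) (nbhs (g x))); [exact: cf|exact: cg].
Qed.

Lemma continuous_comp2 (X Y Z : topologicalType) (f : X -> Y) (g : Y -> Z) :
  continuous f -> continuous g -> continuous (fun x => g (f x)).
Proof. by move=> cf cg x; apply: continuous_comp; [exact: cf|exact: cg]. Qed.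

Section Caratheodory.
Context (R : realType).

(* f is the limit of the functions (p, y) |-> f (p, floor ((k+1) y) / (k+1)). *)
Lemma measurable_caratheodory d (T : measurableType d) (f : T * R -> R) :
  (forall p, continuous (fun y => f (p, y))) ->
  (forall y, measurable_fun setT (fun p => f (p, y))) ->
  measurable_fun setT f.
Proof.
move=> cf mf; pose fl (k : nat) (y : R) : R := (Num.floor (k.+1%:R * y))%:~R / k.+1%:R.
have flP k (y : R) : (Num.floor (k.+1%:R * y))%:~R <= k.+1%:R * y
      < (Num.floor (k.+1%:R * y) + 1)%:~R by exact: Num.Theory.floor_itv.
have flc y : fl ^~ y @ \oo --> y.
  apply/cvgrPdist_le => e e0.
  have := near_infty_natSinv_lt (PosNum e0); apply: filterS => k ke.
  have k0 : (0 : R) < k.+1%:R by rewrite ltr0n.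
  have /andP[h1 h2] := flP k y.
  have h0 : 0 <= y - fl k y by rewrite subr_ge0 /fl ler_pdivrMr// [y * _]mulrC.
  rewrite (ger0_norm h0) /fl.
  apply: le_trans (ltW ke); rewrite -[X in _ <= X]mul1r lerBlDr -mulrDl ler_pdivlMr//.
  by rewrite [y * _]mulrC addrC -intrD1 ltW.
have mk k : measurable_fun setT (fun a : T * R => f (a.1, fl k a.2)).
  have k0 : (0 : R) < k.+1%:R by rewrite ltr0n.
  move=> _ B mB; rewrite setTI.
  rewrite (_ : _ @^-1` B = \bigcup_(j : int)
     ((fun p => f (p, j%:~R / k.+1%:R)) @^-1` B `*`
      `[j%:~R / k.+1%:R, (j + 1)%:~R / k.+1%:R[)).
    apply: countable_bigcupT_measurable => // j; apply: measurableX.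
      by rewrite -[X in measurable X]setTI; exact: mf.
    exact: measurable_itv.
  have flE (j : int) (y : R) : (y \in `[j%:~R / k.+1%:R, (j + 1)%:~R / k.+1%:R[) =
      (Num.floor (k.+1%:R * y) == j).
    by rewrite in_itv/= Num.Theory.floor_eq ler_pdivrMr// ltr_pdivlMr// [y * _]mulrC.
  apply/seteqP; split=> -[p y]; rewrite /preimage/=.
    by move=> h; exists (Num.floor (k.+1%:R * y)) => //; split => //=; rewrite flE.
  by move=> [j _ [/= + yj]]; move: yj; rewrite flE /fl => /eqP->.
apply: (measurable_fun_cvg mk) => -[p y] _ /=.
exact: (cvg_comp (fun k => fl k y) (fun y => f (p, y)) (flc y) (cf p y)).
Qed.

Lemma continuous_measurable2 (f : R * R -> R) : continuous f -> measurable_fun setT f.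
Proof.
move=> cf; apply: measurable_caratheodory => [p|y].
  by apply: continuous_comp2 cf; apply: continuous_pair2 => ?; [exact: cvg_cst|exact: cvg_id].
apply: continuous_measurable_fun.
by apply: continuous_comp2 cf; apply: continuous_pair2 => ?; [exact: cvg_id|exact: cvg_cst].
Qed.

Lemma continuous_measurable3 (f : R * R * R -> R) : continuous f -> measurable_fun setT f.
Proof.
move=> cf; apply: measurable_caratheodory => [p|y].
  by apply: continuous_comp2 cf; apply: continuous_pair2 => ?; [exact: cvg_cst|exact: cvg_id].
apply: continuous_measurable2.
by apply: continuous_comp2 cf; apply: continuous_pair2 => ?; [exact: cvg_id|exact: cvg_cst].
Qed.

(** The variables are regrouped so that the last factor is the one to be integrated out by
    [measurable_Rintegral_param]. *)
Lemma continuous_measurable4 (f : R * R * (R * R) -> R) : continuous f ->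
  measurable_fun setT (fun a : R * R * R * R => f (a.1.1, (a.1.2, a.2))).
Proof.
move=> cf; apply: measurable_caratheodory => [[p x]|y] /=.
  apply: (@continuous_comp2 _ _ _ (fun y : R => (p, (x, y)))) cf.
  apply: continuous_pair2 => [?|]; first exact: cvg_cst.
  by apply: continuous_pair2 => ?; [exact: cvg_cst|exact: cvg_id].
apply: continuous_measurable3.
apply: (@continuous_comp2 _ _ _ (fun p : R * R * R => (p.1, (p.2, y)))) cf.
apply: continuous_pair2 => [?|]; first exact: cvg_fst.
by apply: continuous_pair2 => ?; [exact: cvg_snd|exact: cvg_cst].
Qed.

(** Tonelli applies to the positive and negative parts, and the difference of measurable extended
    real functions is measurable even where both are infinite. *)
Lemma measurable_Rintegral_param d (T : measurableType d) (f : T * R -> R) :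
  measurable_fun setT f ->
  measurable_fun setT (fun p => \int[@lebesgue_measure R]_y f (p, y)).
Proof.
move=> mf; have /measurable_EFinP mE := mf.
pose g := fun p : T * R => (f p)%:E.
have mp : measurable_fun setT (fubini_F (@lebesgue_measure R) g^\+)%E.
  by apply: measurable_fun_fubini_tonelli_F => //; exact: measurable_funepos.
have mn : measurable_fun setT (fubini_F (@lebesgue_measure R) g^\-)%E.
  by apply: measurable_fun_fubini_tonelli_F => //; exact: measurable_funeneg.
rewrite /Rintegral; apply: measurableT_comp => //.
have E : (fun p => \int[@lebesgue_measure R]_y (f (p, y))%:E)%E =
    (fubini_F (@lebesgue_measure R) g^\+ \- fubini_F (@lebesgue_measure R) g^\-)%E.
  apply/funext => p; rewrite integralE.
  by congr (_ - _)%E; apply: eq_integral => y _; rewrite ?funeposE ?funenegE.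

rewrite E; exact: emeasurable_funB.
Qed.

End Caratheodory.

Section Comparison.
Context d (T : measurableType d) (R : realType) (m : {measure set T -> \bar R}).

Lemma bounded_supp_integrable (A : set T) (f : T -> R) (B : R) :
  measurable A -> (m A < +oo)%E -> measurable_fun setT f ->
  (forall x, `|f x| <= B) -> (forall x, ~ A x -> f x = 0) ->
  m.-integrable setT (EFin \o f).
Proof.
move=> mA mAoo mf fB f0.
have -> : EFin \o f = (EFin \o f) \_ A.
  apply/funext => x; rewrite patchE; case: ifPn => // /negP xA /=.
  by rewrite f0// => Ax; apply: xA; rewrite inE.
apply/(integrable_mkcond _ mA); apply: measurable_bounded_integrable => //.
  exact: measurable_funTS.
exists B; split; first exact: num_real.
by move=> M BM x _; exact: le_trans (ltW BM).
Qed.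

Lemma le_dominated_integrable (f g : T -> R) :
  measurable_fun setT f -> (forall x, `|f x| <= g x) ->
  m.-integrable setT (EFin \o g) -> m.-integrable setT (EFin \o f).
Proof.
move=> mf fg; apply: le_integrable => //; first exact/measurable_EFinP.
by move=> x _; rewrite lee_fin (le_trans (fg x))// ler_norm.
Qed.

(** The step repeated for t, x, z and w. Integrability of f is a consequence: f - g1 is dominated by
    g, and g1 is integrable. *)
Lemma Rintegral_dist_le (f g1 g : T -> R) :
  measurable_fun setT f ->
  m.-integrable setT (EFin \o g1) -> m.-integrable setT (EFin \o g) ->
  (forall x, `|f x - g1 x| <= g x) ->
  `|\int[m]_x f x - \int[m]_x g1 x| <= \int[m]_x g x.
Proof.
move=> mf ig1 ig h.
have mg1 : measurable_fun setT g1 by apply/measurable_EFinP/measurable_int; exact: ig1.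
have ifg : m.-integrable setT (EFin \o (fun x => f x - g1 x)).
  by apply: (@le_dominated_integrable _ g) => //; exact: measurable_funB.
have if' : m.-integrable setT (EFin \o f).
  have -> : EFin \o f = ((EFin \o (fun x => f x - g1 x)%R) \+ (EFin \o g1))%E.
    by apply/funext => x /=; rewrite -EFinD subrK.
  exact: integrableD.
rewrite -RintegralB//; apply: (le_trans (le_normr_Rintegral _ ifg)) => //.
apply: le_Rintegral => //.
apply: (@le_dominated_integrable _ g) => // [|x]; last by rewrite normr_id.
by apply: measurableT_comp => //; exact: measurable_funB.
Qed.

Lemma integrable_change_var (phi : T -> T) (c : R) (f : T -> R) :
  measurable_fun setT phi -> 0 <= c ->
  (forall A, measurable A -> m (phi @^-1` A) = (c%:E * m A)%E) ->
  (forall x, 0 <= f x) ->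
  m.-integrable setT (EFin \o f) -> m.-integrable setT (EFin \o (f \o phi)).
Proof.
move=> mphi c0 cm f0 /integrableP[mf foo]; apply/integrableP; split.
  exact: (measurableT_comp mf mphi).
have aE (u : T -> R) : (forall x, 0 <= u x) -> (fun x => `|(u x)%:E|%E) = EFin \o u.
  by move=> u0; apply/funext => x /=; rewrite ger0_norm.
move: foo; rewrite /= (aE f)// (aE (f \o phi))//; last by move=> x /=.
move=> foo.
have fE0 y : setT y -> (0 <= (EFin \o f) y)%E by rewrite lee_fin.
rewrite -[X in (X < _)%E](@ge0_integral_pushforward _ _ _ _ _ _ mphi m setT (EFin \o f))//;
  last by move=> y _; exact: fE0.
rewrite (@eq_measure_integral _ _ _ _ (mscale (NngNum c0) m)); last first.
  by move=> A mA _; exact: cm.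
rewrite ge0_integral_mscale//; exact: lte_mul_pinfty.
Qed.

End Comparison.

(** * Dirac sequences as kernels *)

Lemma lebesgue_itvcc_fin (R : realType) (a b : R) :
  (lebesgue_measure `[a, b] < +oo)%E.
Proof. by rewrite lebesgue_measure_itv/=; case: ifP => // _; rewrite -EFinB ltry. Qed.

Section Kernel.
Context {R : realType} (D : frobLattice R).
Local Notation V := (Vxi D).
Local Notation bV := (borelVxi D).
Local Notation leb := (@lebesgue_measure R).
Local Notation leb2 := ((leb \x leb)%E).

Lemma measurable_locally_constant (n : nat) (f : V -> R) :
  (forall w k, Vxi_nbhd n k -> f (w + k) = f w) ->
  measurable_fun [set: bV] (f : bV -> R).
Proof.
move=> fn _ B _; rewrite setTI; apply: open_measurableV; rewrite open_VballP.
move=> w Bw; exists n => y yw; rewrite /preimage/=.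
by rewrite -(subrK w y) addrC fn.
Qed.

Variables (mu : {measure set bV -> \bar R}) (K : R[i] * V * R -> R) (dl : R) (m : nat).
Hypothesis K0 : forall y, 0 <= K y.
Hypothesis Kc : forall w, continuous (fun a : R * R * R => K (a.1.1 +i* a.1.2, w, a.2)).
Hypothesis Kper : forall z w k u, Vxi_nbhd m k -> K (z, w + k, u) = K (z, w, u).
Hypothesis Ksupp : forall y, K y != 0 ->
  [/\ `|complex.Re y.1.1| < dl, `|complex.Im y.1.1| < dl & `|y.2| < dl].
Hypothesis Kint : int_target mu K = 1.

(** [K] stands for one term of a Dirac sequence. Its partial integrals follow the nesting of
    [int_target], so that the integral of [kQ] is the total mass 1 by definition. *)
Definition kslice w (a : R * R * R) : R := K (a.1.1 +i* a.1.2, w, a.2).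
Definition kP w (a : R * R) : R := \int[leb]_u kslice w (a, u).
Definition kQ w : R := \int[leb2]_a kP w a.

Lemma kslice_bounded w : exists B, forall a, `|kslice w a| <= B.
Proof.
pose A : set (R * R * R) := (`[- dl, dl] `*` `[- dl, dl]) `*` `[- dl, dl].
have cA : compact A.
  by apply: compact_setX; [apply: compact_setX|]; exact: segment_compact.
have : compact (kslice w @` A).
  apply: continuous_compact => //; apply: continuous_subspaceT; exact: Kc.
move=> /compact_bounded[M [_ MB]]; exists (`|M| + 1) => a.
have [e|/Ksupp/= [h1 h2 h3]] := eqVneq (kslice w a) 0.
  by rewrite e normr0 addr_ge0.
apply: MB; first by rewrite ltr_pwDr// ler_norm.
by exists a => //; split; [split|] => /=; rewrite in_itv/= -ler_norml ltW.
Qed.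

Lemma measurable_kslice w : measurable_fun setT (kslice w).
Proof. by apply: continuous_measurable3; exact: Kc. Qed.

Lemma kslice_integrable w a : leb.-integrable setT (EFin \o (fun u => kslice w (a, u))).
Proof.
have [B hB] := kslice_bounded w.
apply: (@bounded_supp_integrable _ (measurableTypeR R) R leb `[- dl, dl]%classic
  (fun u => kslice w (a, u)) B) => //.
- exact: lebesgue_itvcc_fin.
- exact: (measurable_fun_pair2 _ (measurable_kslice w)).
- move=> u nu; apply/eqP/negPn/negP => /Ksupp/= [_ _ h3]; apply: nu.
  by rewrite /= in_itv/= -ler_norml ltW.
Qed.

Lemma kP_ge0 w a : 0 <= kP w a.
Proof. by apply: Rintegral_ge0 => u _; exact: K0. Qed.

Lemma measurable_kP w : measurable_fun setT (kP w).
Proof. by apply: measurable_Rintegral_param; exact: measurable_kslice. Qed.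

Lemma kP_integrable w : leb2.-integrable setT (EFin \o kP w).
Proof.
have [B hB] := kslice_bounded w.
pose I : set R := `[- dl, dl]%classic.
have mI : measurable I by exact: measurable_itv.
have Ioo : (leb I < +oo)%E.
  exact: lebesgue_itvcc_fin.
have IIoo : (leb2 (I `*` I) < +oo)%E.
  by rewrite product_measure1E//; apply: lte_mul_pinfty => //; rewrite ge0_fin_numE.
apply: (@bounded_supp_integrable _ (measurableTypeR R * measurableTypeR R)%type R
  leb2 (I `*` I) (kP w) (B * fine (leb I))) => //.
- exact: measurableX.
- exact: measurable_kP.
- move=> a; rewrite ger0_norm ?kP_ge0//.
  rewrite /kP -Rintegral_cst// [X in _ <= X]Rintegral_mkcond.
  apply: le_Rintegral => //; first exact: kslice_integrable.
    rewrite -restrict_EFin.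
    apply: (iffLR (@integrable_mkcond _ (measurableTypeR R) R leb I (EFin \o cst B) mI)).
    apply: (@measurable_bounded_integrable _ (measurableTypeR R) R leb (cst B) I) => //.
    by exists `|B|; split => [|M BM u _] /=; [exact: num_real|exact: ltW].
  move=> u _; rewrite patchE; case: ifPn => [_|/negP ui].
    by apply: le_trans (hB (a, u)); exact: ler_norm.
  rewrite (_ : kslice w (a, u) = 0)//; apply/eqP/negPn/negP => /Ksupp/= [_ _ h3].
  by apply: ui; rewrite inE /I/= in_itv/= -ler_norml ltW.
- move=> a na; rewrite /kP (_ : (fun u => kslice w (a, u)) = cst 0).
    by rewrite Rintegral_cst// mul0r.
  apply/funext => u /=; apply/eqP/negPn/negP => /Ksupp/= [h1 h2 _].
  by apply: na; split; rewrite /I/= in_itv/= -ler_norml ltW.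
Qed.

Lemma kQ_ge0 w : 0 <= kQ w.
Proof. by apply: Rintegral_ge0 => a _; exact: kP_ge0. Qed.

Lemma measurable_kQ : measurable_fun [set: bV] (kQ : bV -> R).
Proof.
apply: (@measurable_locally_constant m) => w k km.
apply: eq_Rintegral => a _; apply: eq_Rintegral => u _.
by rewrite /kslice Kper.
Qed.

Lemma kQ_int : \int[mu]_w kQ w = 1.
Proof. exact: Kint. Qed.

(** [kQ] is nonnegative, and an infinite integral would be turned by [Rintegral] into 0, against the
    total mass 1. *)
Lemma kQ_integrable : mu.-integrable [set: bV] (EFin \o (kQ : bV -> R)).
Proof.
apply/integrableP; split; first by apply/measurable_EFinP; exact: measurable_kQ.
rewrite (_ : (fun x => _) = (fun w => (kQ w)%:E)); last first.
  by apply/funext => w /=; rewrite ger0_norm// kQ_ge0.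
rewrite ltey; apply/eqP => e; have := kQ_int; rewrite /Rintegral e/= => /esym/eqP.
by rewrite oner_eq0.
Qed.

End Kernel.

(** * The measure dx / x on [1, q[ *)

Section Weight.
Context {R : realType}.
Local Notation leb := (@lebesgue_measure R).

Definition dlog_weight (q x : R) : R := \1_(`[1, q[ : set R) x * x^-1.

(** The truncated factor is continuous and nonnegative on the whole line, whereas 1 / x is
    neither. *)
Lemma dlog_weightE (q : R) : dlog_weight q =
  (fun x => \1_(`[1, q[ : set R) x * (Num.max x 1)^-1).
Proof.
apply/funext => x; rewrite /dlog_weight indicE; case: (boolP (x \in _)) => [|_].
  by rewrite inE/= in_itv/= => /andP[x1 _]; rewrite max_l.
by rewrite !mul0r.
Qed.

Lemma dlog_weight_ge0 (q x : R) : 0 <= dlog_weight q x.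
Proof.
by rewrite dlog_weightE mulr_ge0// invr_ge0 le_max ler01 orbT.
Qed.

Lemma measurable_dlog_weight (q : R) : measurable_fun setT (dlog_weight q).
Proof.
rewrite dlog_weightE; apply: measurable_funM; first exact: measurable_indic.
apply: continuous_measurable_fun => x; apply: cvgV.
  by rewrite gt_eqF// lt_max ltr01 orbT.
by apply: continuous_max; [exact: cvg_id|exact: cvg_cst].
Qed.

Lemma dlog_weight_integrable (q : R) (f : R -> R) : continuous f ->
  leb.-integrable setT (EFin \o (fun x => dlog_weight q x * f x)).
Proof.
move=> cf.
have : compact (f @` `[1, q]).
  apply: continuous_compact; last exact: segment_compact.
  exact: continuous_subspaceT.
move=> /compact_bounded[M [_ MB]].
have M0 : 0 <= `|M| + 1 by rewrite addr_ge0.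
apply: (@bounded_supp_integrable _ (measurableTypeR R) R leb `[1, q]%classic _ (`|M| + 1)) => //.
- exact: lebesgue_itvcc_fin.
- apply: measurable_funM; first exact: measurable_dlog_weight.
  exact: continuous_measurable_fun.
- move=> x; rewrite normrM ger0_norm ?dlog_weight_ge0// dlog_weightE indicE.
  case: (boolP (x \in _)) => [|_]; last by rewrite !mul0r.
  rewrite inE/= in_itv/= => /andP[x1 xq]; rewrite max_l//.
  rewrite -[leRHS]mul1r; apply: ler_pM => //.
  - by rewrite mul1r invr_ge0 (le_trans ler01).
  - by rewrite mul1r invf_le1// (lt_le_trans ltr01).
  - by apply: MB; [rewrite ltr_pwDr// ler_norm|exists x => //=; rewrite in_itv/= x1 ltW].
- move=> x xn; rewrite /dlog_weight indicE memNset ?mul0r// => /= h; apply: xn.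
  by move: h; rewrite /= !in_itv/= => /andP[-> /ltW].
Qed.

End Weight.

(** * Integration against a kernel *)

Section Estimate.
Context {R : realType} (D : frobLattice R).
Local Notation V := (Vxi D).
Local Notation bV := (borelVxi D).
Local Notation q := ((fl_q D)%:R : R).
Local Notation t0 := (- ln q).
Local Notation leb := (@lebesgue_measure R).
Local Notation leb2 := ((leb \x leb)%E).

Variables (mu : {measure set bV -> \bar R}) (hmu : is_haar mu) (gam : R[i]).
Local Notation mapC := (mapC D gam).
Local Notation mapV := (@mapV R D gam).
Local Notation mapC2 := (mapC2 D gam).
Local Notation J := (complex.Re `|(xi D)^-1 - 1| ^+ 2).

Variables (K : R[i] * V * R -> R) (dl : R) (m : nat).
Hypothesis K0 : forall y, 0 <= K y.
Hypothesis Kc : forall w, continuous (fun a : R * R * R => K (a.1.1 +i* a.1.2, w, a.2)).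
Hypothesis Kper : forall z w k u, Vxi_nbhd m k -> K (z, w + k, u) = K (z, w, u).
Hypothesis Ksupp : forall y, K y != 0 ->
  [/\ `|complex.Re y.1.1| < dl, `|complex.Im y.1.1| < dl & `|y.2| < dl].
Hypothesis Kint : int_target mu K = 1.

Variables (h : R[i] * V * (R * R) -> R) (N : set (R[i] * V)) (I : set R).
Variables (z0 : R[i]) (w0 : V) (eps : R).
Hypothesis hc : forall w,
  continuous (fun a : R * R * (R * R) => h (a.1.1 +i* a.1.2, w, a.2)).
Hypothesis hK : forall z w t, K (mapC z, mapV w, t0 - t) != 0 ->
  [/\ N (z, w), I t, forall x, h (z, w, (x, t)) = h (z, w0, (x, t)) &
    forall x, 1 <= x < q -> `|h (z, w0, (x, t)) - h (z0, w0, (x, t0))| <= eps].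

Let h0 x := h (z0, w0, (x, t0)).
(** Here [w] is already a value of [mapV], and [h] is taken at [w0]: the dependence on [w] is
    through [K] alone, hence locally constant and measurable. *)
Let It w (p : R * R * R) : R := \int[leb]_t
  (kslice K w (mapC2 p.1, t0 - t) * h (p.1.1 +i* p.1.2, w0, (p.2, t))).
Let Ix w (a : R * R) : R := \int[leb]_x (dlog_weight q x * It w (a, x)).
Let H0 : R := \int[leb]_x (dlog_weight q x * h0 x).
Let cq : R := \int[leb]_x dlog_weight q x.

Let measurable_reflect : measurable_fun setT (fun t : R => t0 - t).
Proof. by apply: measurable_funB => //; exact: measurable_cst. Qed.

Let lebesgue_reflect (A : set R) : measurable A ->
  leb ((fun t => t0 - t) @^-1` A) = (1%:E * leb A)%E.
Proof.
move=> mA; have := @lebesgue_affine R (-1) t0 A _ mA.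
rewrite normrN1 invr1 => <-; last by rewrite oppr_eq0 oner_neq0.
by congr (leb (_ @^-1` A)); apply/funext => t; rewrite mulN1r addrC.
Qed.

(** The time enters the kernel as - ln q - t, so the integral over t is the one over u after a
    reflection, of Jacobian 1. *)
Let kP_reflect w a : \int[leb]_t kslice K w (a, t0 - t) = kP K w a.
Proof.
have := @Rintegral_change_var _ (measurableTypeR R) R leb (fun t => t0 - t) 1
  (fun u => kslice K w (a, u)) measurable_reflect ler01 lebesgue_reflect
  (measurable_fun_pair2 a (measurable_kslice Kc w)) (fun u => K0 _).
by rewrite mul1r.
Qed.

Let kslice_reflect_integrable w a :
  leb.-integrable setT (EFin \o (fun t => kslice K w (a, t0 - t))).
Proof.
exact: (@integrable_change_var _ (measurableTypeR R) R leb (fun t => t0 - t) 1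
  (fun u => kslice K w (a, u)) measurable_reflect ler01 lebesgue_reflect
  (fun u => K0 _) (kslice_integrable Kc Ksupp w a)).
Qed.

Let measurable_It w : measurable_fun setT (It w).
Proof.
apply: (@measurable_Rintegral_param R _ (R * R * R)%type
  (fun p : R * R * R * R => kslice K w (mapC2 p.1.1, t0 - p.2) *
     h (p.1.1.1 +i* p.1.1.2, w0, (p.1.2, p.2)))).
apply: measurable_funM; last exact: (continuous_measurable4 (@hc w0)).
have [mC _] := scales_mapC2 D gam.
have mp : measurable_fun setT (fun p : R * R * R * R => (mapC2 p.1.1, t0 - p.2)).
  apply: measurable_fun_pair.
    apply: (measurableT_comp mC); exact: measurableT_comp.
  exact: (measurableT_comp measurable_reflect).
exact: (measurableT_comp (measurable_kslice Kc w) mp).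
Qed.

Let measurable_Ix w : measurable_fun setT (Ix w).
Proof.
apply: (@measurable_Rintegral_param R _ (R * R)%type
  (fun p : R * R * R => dlog_weight q p.2 * It w (p.1, p.2))).
apply: measurable_funM.
  exact: (measurableT_comp (measurable_dlog_weight _)).
rewrite (_ : (fun x => _) = It w); first exact: measurable_It.
by apply/funext => -[a x].
Qed.

(* The bound on h near the orbit is integrated successively over t, x, z and w. *)
Let level_t w a x : 1 <= x < q ->
  `|It (mapV w) (a, x) - h0 x * kP K (mapV w) (mapC2 a)| <= eps * kP K (mapV w) (mapC2 a).
Proof.
move=> x1q; rewrite -!kP_reflect -!RintegralZl//; [|exact: kslice_reflect_integrable..].
apply: Rintegral_dist_le.
- apply: measurable_funM.
    exact: (measurableT_comp (measurable_fun_pair2 _ (measurable_kslice Kc _)) measurable_reflect).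
  exact: (measurable_fun_pair2 (a, x) (continuous_measurable4 (@hc w0))).
- exact: (integrableZl measurableT (h0 x) (kslice_reflect_integrable _ _)).
- exact: (integrableZl measurableT eps (kslice_reflect_integrable _ _)).
move=> t /=; have [->|e] := eqVneq (kslice K (mapV w) (mapC2 a, t0 - t)) 0.
  by rewrite mul0r !mulr0 subrr normr0.
move: (e); rewrite /kslice/= mapC2K => /hK[_ _ _ /(_ x x1q) hx].
rewrite [h0 x * _]mulrC -mulrBr normrM ger0_norm ?K0// mulrC ler_wpM2r ?K0//.
Qed.

Let level_x w a :
  `|Ix (mapV w) a - H0 * kP K (mapV w) (mapC2 a)| <= eps * cq * kP K (mapV w) (mapC2 a).
Proof.
set P := kP _ _ _; have P0 : 0 <= P by exact: kP_ge0.
have h0c : continuous h0.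
  have := @hc w0; rewrite /h0; case: (z0) => [z1 z2] c4.
  apply: (continuous_comp2 (f := fun x : R => ((z1, z2), (x, t0))) _ c4).
  apply: continuous_pair2 => [?|]; first exact: cvg_cst.
  by apply: continuous_pair2 => ?; [exact: cvg_id|exact: cvg_cst].
have i1 := dlog_weight_integrable q h0c.
have i2 : leb.-integrable setT (EFin \o dlog_weight q).
  have e : dlog_weight q = (fun x => dlog_weight q x * 1).
    by apply/funext => x; rewrite mulr1.
  by rewrite e; apply: (@dlog_weight_integrable R q (fun=> 1)) => x; exact: cvg_cst.
rewrite /H0 /cq mulrAC -RintegralZr// -RintegralZl//.
apply: Rintegral_dist_le.
- apply: measurable_funM; first exact: measurable_dlog_weight.
  exact: (measurable_fun_pair2 _ (measurable_It _)).
- exact: (integrableZr measurableT P i1).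
- exact: (integrableZl measurableT (eps * P) i2).
move=> x; have [x1q|nx] := boolP (1 <= x < q).
  rewrite -mulrA -mulrBr normrM ger0_norm ?dlog_weight_ge0//.
  by rewrite [leRHS]mulrC ler_wpM2l ?dlog_weight_ge0// level_t.
have -> : dlog_weight q x = 0.
  by rewrite /dlog_weight indicE memNset ?mul0r//= in_itv/=; exact/negP.
by rewrite !mul0r mulr0 subrr normr0.
Qed.

Let scale_invJ : 0 <= J^-1.
Proof. by rewrite invr_ge0 ltW// jac_gt0. Qed.

Let level_z w : `|\int[leb2]_a Ix (mapV w) a - H0 * J^-1 * kQ K (mapV w)|
  <= eps * cq * J^-1 * kQ K (mapV w).
Proof.
have [mC sC] := scales_mapC2 D gam.
have kE : \int[leb2]_a kP K (mapV w) (mapC2 a) = J^-1 * kQ K (mapV w).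
  exact: (@Rintegral_change_var _ (measurableTypeR R * measurableTypeR R)%type R
    leb2 mapC2 _ _ mC scale_invJ sC (measurable_kP Kc _) (kP_ge0 K0 _)).
have kI : leb2.-integrable setT (EFin \o (fun a => kP K (mapV w) (mapC2 a))).
  exact: (@integrable_change_var _ (measurableTypeR R * measurableTypeR R)%type R
    leb2 mapC2 _ _ mC scale_invJ sC (kP_ge0 K0 _) (kP_integrable K0 Kc Ksupp _)).
rewrite -(mulrA H0) -(mulrA (eps * cq)) -kE.
have := level_x w; move: (eps * cq) => c lx; rewrite -!RintegralZl//.
apply: Rintegral_dist_le.
- exact: measurable_Ix.
- exact: (integrableZl measurableT H0 kI).
- exact: (integrableZl measurableT c kI).
- exact: lx.
Qed.

Let level_w : `|\int[mu]_w \int[leb2]_a Ix (mapV w) a - J^-1 * (q^-1 * H0)|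
  <= eps * cq * J^-1 * q^-1.
Proof.
have iq : 0 <= q^-1 by rewrite invr_ge0 ltW// q_gt0.
have mQ := measurable_kQ Kper.
have kE : \int[mu]_w kQ K (mapV w) = q^-1.
  rewrite (@Rintegral_change_var _ bV R mu mapV _ _ (measurable_mapV gam) iq
    (@haar_mapV _ _ _ hmu gam) mQ (kQ_ge0 K0)).
  by rewrite (kQ_int Kint) mulr1.
have kI : mu.-integrable [set: bV] (EFin \o (fun w : bV => kQ K (mapV w))).
  exact: (@integrable_change_var _ bV R mu mapV _ _ (measurable_mapV gam) iq
    (@haar_mapV _ _ _ hmu gam) (kQ_ge0 K0) (kQ_integrable K0 Kper Kint)).
have -> : J^-1 * (q^-1 * H0) = H0 * J^-1 * q^-1 by ring.
have := level_z; move: (H0 * J^-1) (eps * cq * J^-1) => H1 c lz.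
rewrite -kE -!RintegralZl//.
apply: Rintegral_dist_le.
(* The iterated integral is constant on cosets of level m because [K] is; composing with [mapV]
   comes afterwards. *)
- have mI : measurable_fun [set: bV] (fun w : bV => \int[leb2]_a Ix w a).
    apply: (@measurable_locally_constant _ _ m) => w k km.
    apply: eq_Rintegral => a _; apply: eq_Rintegral => x _; congr (_ * _).
    by apply: eq_Rintegral => t _; rewrite /kslice Kper.
  exact: (measurableT_comp mI (measurable_mapV gam)).
- exact: (integrableZl measurableT H1 kI).
- exact: (integrableZl measurableT c kI).
- exact: lz.
Qed.

Let diff_mapE z w x t : 0 < x ->
  diff_map gam (z, w, (x, t)) = (mapC z, mapV w, t0 - t).
Proof.
move=> x0; have q0 := q_gt0 D; rewrite /diff_map/=; congr (_, _, _).
rewrite !lnM ?posrE ?mulr_gt0 ?invr_gt0 ?expR_gt0// lnV ?posrE//.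
by rewrite expRK addrAC addrK.
Qed.

(** The tube imposes both (z, w) in N and x in [1, q[. Where the kernel is nonzero for some t the
    first condition holds, so the indicator is that of [1, q[; elsewhere both sides vanish. *)
Let tube_slice z w x : 0 < x ->
  (\1_(tubeU N) (z, w, x) : R) *
   \int[leb]_(t in I) (K (diff_map gam (z, w, (x, t))) * h (z, w, (x, t))) / x =
  dlog_weight q x * \int[leb]_t (K (mapC z, mapV w, t0 - t) * h (z, w0, (x, t))).
Proof.
move=> x0.
have -> : \int[leb]_(t in I) (K (diff_map gam (z, w, (x, t))) * h (z, w, (x, t))) =
    \int[leb]_t (K (mapC z, mapV w, t0 - t) * h (z, w0, (x, t))).
  rewrite Rintegral_mkcond; apply: eq_Rintegral => t _.
  rewrite patchE diff_mapE//.
  have [e|/hK[_ It' -> _]] := eqVneq (K (mapC z, mapV w, t0 - t)) 0.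
    by rewrite e !mul0r if_same.
  by rewrite mem_set.
have [[t /eqP nt]|nt] := pselect (exists t, K (mapC z, mapV w, t0 - t) <> 0).
  have [Nzw _ _ _] := hK nt; rewrite mulrAC; congr (_ * _).
  rewrite /dlog_weight !indicE; congr (_%:R * _); congr nat_of_bool.
  have q0 := q_gt0 D; have q1 : 1 < q by rewrite ltr1n fl_q_gt1.
  apply/idP/idP; rewrite !inE /tubeU/= in_itv/=.
    move=> [_ [s /andP[s1 s2] ->]]; rewrite -[X in X <= _]expR0 ler_expR oppr_ge0 s2/=.
    by rewrite -[q]lnK ?posrE// ltr_expR ltrNl.
  move=> /andP[x1 xq]; split=> //; exists (- ln x); last by rewrite opprK lnK.
  by rewrite ltrN2 oppr_le0 ln_ge0// andbT ltr_ln.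
have -> : \int[leb]_t (K (mapC z, mapV w, t0 - t) * h (z, w0, (x, t))) = 0.
  rewrite (_ : (fun t => _) = cst 0); first by rewrite Rintegral_cst// mul0r.
  apply/funext => t /=; rewrite (_ : K _ = 0) ?mul0r//.
  by apply: contrapT => e; apply: nt; exists t.
by rewrite mulr0 mul0r mulr0.
Qed.

(** The error is eps times the mass of the limit: [cq] is the mass of dx / x on [1, q[, and the
    inverse Jacobians come from the changes of variable in z and w. *)
Lemma tube_estimate :
  `|int_tube mu (tubeU N) I (fun y => K (diff_map gam y) * h y)
    - J^-1 * (q^-1 * dirac_orbit (D := D) z0 w0 t0 h)|
  <= eps * cq * J^-1 * q^-1.
Proof.
have -> : dirac_orbit (D := D) z0 w0 t0 h = H0.
  rewrite /dirac_orbit Rintegral_mkcond; apply: eq_Rintegral => x _.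
  rewrite patchE /dlog_weight indicE; case: ifP => _; last by rewrite !mul0r.
  by rewrite mul1r mulrC.
rewrite (_ : int_tube _ _ _ _ = \int[mu]_w \int[leb2]_a Ix (mapV w) a).
  exact: level_w.
apply: eq_Rintegral => w _; apply: eq_Rintegral => a _.
rewrite Rintegral_mkcond; apply: eq_Rintegral => x _.
rewrite patchE; case: ifPn => [|nx].
  rewrite inE/= in_itv/= andbT => x0; rewrite tube_slice//; congr (_ * _).
  by apply: eq_Rintegral => t _; rewrite /kslice/= mapC2K.
rewrite /Ix /dlog_weight indicE memNset ?mul0r//= in_itv/= => /andP[x1 _].
by move/negP: nx; apply; rewrite inE/= in_itv/= andbT (lt_le_trans ltr01).
Qed.

End Estimate.

(** * The pull-back of the Dirac distribution *)

Section Nbhs.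
Context {R : realType} (D : frobLattice R).

Lemma normc_ge_ReIm (z : R[i]) :
  `|complex.Re z|%:C <= `|z| /\ `|complex.Im z|%:C <= `|z|.
Proof.
rewrite normc_def !lecR; split; rewrite -sqrtr_sqr ler_wsqrtr// ?lerDl ?lerDr ?sqr_ge0//.
Qed.

Lemma normc_le_ReIm (z : R[i]) : `|z| <= (`|complex.Re z| + `|complex.Im z|)%:C.
Proof.
rewrite normc_def lecR -[leRHS]ger0_norm ?addr_ge0// -sqrtr_sqr ler_wsqrtr//.
rewrite sqrrD !real_normK ?num_real// -addrA lerD2l -[leLHS]add0r lerD2r.
by rewrite mulrn_wge0// mulr_ge0.
Qed.

Definition boxC (z : R[i]) (dl : R) : set R[i] :=
  [set y | `|complex.Re (y - z)| < dl /\ `|complex.Im (y - z)| < dl].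

Lemma nbhs_boxC z dl : 0 < dl -> nbhs z (boxC z dl).
Proof.
move=> dl0; change (nbhs (z : R[i]^o) (boxC z dl)).
apply/nbhs_ballP; exists dl%:C => /=; first by rewrite ltcR.
move=> y; rewrite -ball_normE/= distrC => h; have [h1 h2] := normc_ge_ReIm (y - z).
by split; rewrite -ltcR; [exact: le_lt_trans h1 h|exact: le_lt_trans h2 h].
Qed.

Lemma nbhs_boxCP z (A : set R[i]) : nbhs z A -> exists2 dl, 0 < dl & boxC z dl `<=` A.
Proof.
move=> zA; have : nbhs (z : R[i]^o) A by [].
(* A radius in R[i] is itself complex, and positivity forces its imaginary part to be 0. Halving it
   below pays for bounding the modulus by |Re| + |Im|. *)
move=> /nbhs_ballP[[e e'] /=]; rewrite ltcE/= => /andP[/eqP -> e0] h.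
exists (e / 2); first by rewrite divr_gt0.
move=> y [y1 y2]; apply: h; rewrite -ball_normE/= distrC.
apply: (le_lt_trans (normc_le_ReIm _)); rewrite -[ltRHS]/(e%:C) ltcR.
by rewrite [ltRHS]splitr ltrD.
Qed.

Definition box (dl : R) (n : nat) : set (R[i] * Vxi D * R) :=
  [set y | [/\ boxC 0 dl y.1.1, Vball n 0 y.1.2 & `|y.2| < dl]].

Lemma nbhs_box dl n : 0 < dl -> nbhs (0 : R[i], 0 : Vxi D, 0 : R) (box dl n).
Proof.
move=> dl0; exists (boxC 0 dl `*` Vball n 0, [set u : R | `|u| < dl]) => /=.
  split.
    exists (boxC 0 dl, Vball n 0) => //=; split; first exact: nbhs_boxC.
    by apply/nbhs_VballP; exists n.
  apply/nbhs_ballP; exists dl => //= u.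
  by rewrite /ball/= sub0r normrN.
by move=> [[z w] u] [[/= h1 h2] h3].
Qed.

End Nbhs.

(** Uniformity in x is compactness of the segment in its near-covering form: the difference [Phi] is
    continuous and vanishes at each (x, (z, t)), so it stays small around that point. *)
Lemma near_uniform (R : realType) (H : R * R * (R * R) -> R) (a b t e : R) (z : R * R) :
  continuous H -> 0 < e ->
  exists2 dl, 0 < dl & forall y s x, `|y.1 - z.1| < dl -> `|y.2 - z.2| < dl ->
    `|s - t| < dl -> a <= x <= b -> `|H (y, (x, s)) - H (z, (x, t))| <= e.
Proof.
move=> cH e0.
have := @segment_compact R a b; move/compact_near_coveringP => nc.
pose P (i : R * R * R) (x : R) := `|H (i.1, (x, i.2)) - H (z, (x, t))| <= e.
have : \forall i \near nbhs ((z, t) : R * R * R), `[a, b]%classic `<=` P i.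
  apply: nc => x _.
  pose Phi (p : R * (R * R * R)) := H (p.2.1, (p.1, p.2.2)) - H (z, (p.1, t)).
  have cPhi : continuous Phi.
    move=> p; apply: cvgB.
      apply: (continuous_comp2 (f := fun p : R * (R * R * R) => (p.2.1, (p.1, p.2.2))) _ cH).
      apply: continuous_pair2 => [y|].
        by apply: cvg_comp; [exact: cvg_snd|exact: cvg_fst].
      apply: continuous_pair2 => y; first exact: cvg_fst.
      by apply: cvg_comp; [exact: cvg_snd|exact: cvg_snd].
    apply: (continuous_comp2 (f := fun p : R * (R * R * R) => (z, (p.1, t))) _ cH).
    apply: continuous_pair2 => [?|]; first exact: cvg_cst.
    by apply: continuous_pair2 => ?; [exact: cvg_fst|exact: cvg_cst].
  have := cPhi (x, (z, t)); rewrite /continuous_at.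
  rewrite {2}/Phi/= subrr => /cvgrPdist_le/(_ e e0).
  by apply: filterS => p /=; rewrite sub0r normrN.
move=> /nbhs_ballP[dl /= dl0 h]; exists dl => // y s x y1 y2 s1 xab.
apply: (h (y, s)); last by rewrite /= in_itv.
by split; [split|]; rewrite /ball/= distrC.
Qed.

Section Pullback.
Context {R : realType} (D : frobLattice R).
Local Notation V := (Vxi D).
Local Notation bV := (borelVxi D).
Local Notation q := ((fl_q D)%:R : R).
Local Notation J := (complex.Re `|(xi D)^-1 - 1| ^+ 2).
Variables (mu : {measure set bV -> \bar R}) (hmu : is_haar mu) (gam : R[i]).
Variables (z0 : R[i]) (w0 : V).
Hypothesis mapC0 : mapC D gam z0 = 0.
Hypothesis mapV0 : @mapV R D gam w0 = 0.

Lemma mapC_box (dl : R) : 0 < dl -> exists2 dl', 0 < dl' <= dl &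
  forall z, boxC 0 dl' (mapC D gam z) -> boxC z0 dl z.
Proof.
move=> dl0; pose c := (xiV_sub1 D)^-1.
pose M := `|complex.Re c| + `|complex.Im c|.
have M0 : 0 <= M by rewrite addr_ge0.
have M1 : 0 < M + 1 by rewrite ltr_pwDr.
(* The inverse similitude enlarges the coordinates at most M times; M + 1 keeps the bound strict and
   the new radius at most [dl]. *)
exists (dl / (M + 1)).
  by rewrite divr_gt0//= ler_pdivrMr// mulrDr mulr1 lerDr mulr_ge0// ltW.
move=> z; rewrite /boxC/= subr0.
have -> : z - z0 = c * mapC D gam z.
  rewrite -[mapC D gam z]subr0 -mapC0 !mapCE /c.
  by rewrite opprB addrA subrK -mulrBr mulKf ?xiV_sub1_neq0.
case: (mapC D gam z) => [a b] /= [ha hb].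
have key s t : `|s| + `|t| = M -> `|s * a| + `|t * b| < dl.
  move=> st; rewrite !normrM.
  have h1 : `|s| * `|a| <= `|s| * (dl / (M + 1)) by rewrite ler_wpM2l// ltW.
  have h2 : `|t| * `|b| <= `|t| * (dl / (M + 1)) by rewrite ler_wpM2l// ltW.
  apply: le_lt_trans (lerD h1 h2) _; rewrite -mulrDl st mulrA ltr_pdivrMr//.
  by rewrite mulrC ltr_pM2l// ltrDl.
split; case: c @M {M0 M1} ha hb key => [s t] /= ha hb key.
  by apply: le_lt_trans (key s t erefl); exact: ler_normB.
by rewrite addrC; apply: le_lt_trans (key t s (addrC _ _)); rewrite ler_normD.
Qed.

Lemma pullback_dirac (N : set (R[i] * V)) (eps : R) :
  open N -> N (z0, w0) -> 0 < eps ->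
  pullback_dirac_eq mu N `]- eps - ln q, eps - ln q[ (@diff_map R D gam)
    (fun h => J^-1 * (q^-1 * dirac_orbit z0 w0 (- ln q) h)).
Proof.
move=> oN Nzw eps0 rho [rt r0 ri rs] h [_ [nh hper] hsm].
have hc w : continuous (fun a : R * R * (R * R) => h (a.1.1 +i* a.1.2, w, a.2)).
  by have [] := hsm w [::].
have J0 := jac_gt0 D; have q0 := q_gt0 D.
pose cq : R := \int[@lebesgue_measure R]_x dlog_weight q x.
have cq0 : 0 <= cq by apply: Rintegral_ge0 => x _; exact: dlog_weight_ge0.
have M0 : 0 <= cq * J^-1 * q^-1 by rewrite !mulr_ge0// invr_ge0 ltW.
apply/cvgrPdist_le => e e0.
have M1 : 0 < cq * J^-1 * q^-1 + 1 by rewrite ltr_pwDr.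
(* Chosen so that the error bound of [tube_estimate] is at most e; adding 1 avoids a separate case
   for mass 0. *)
pose e1 := e / (cq * J^-1 * q^-1 + 1).
have e10 : 0 < e1 by rewrite divr_gt0.
have [d1 d10 hd1] := near_uniform 1 q (- ln q) (complex.Re z0, complex.Im z0) (hc w0) e10.
have [[A B] /= [/nbhs_boxCP[d2 d20 hA] /nbhs_VballP[nN hB]] hAB] :
  nbhs (z0, w0) N by exact: open_nbhs_nbhs.
(* [d1] makes h close to its value on the orbit, [d2] keeps z inside N, and [eps] keeps t in the
   time interval. *)
pose d := Num.min (Num.min d1 d2) eps.
have d0 : 0 < d by rewrite !lt_min d10 d20.
have [d3 /andP[d30 d3d] hd3] := mapC_box d0.
(* Level [nN] keeps w inside N; at level [nh] the test function no longer distinguishes w from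
   [w0]. *)
have := rs _ (nbhs_box D (maxn nN nh) d30).
apply: filterS => n rn.
have [_ [m rper] rsm] := rt n.
rewrite distrC.
apply: le_trans (_ : e1 * cq * J^-1 * q^-1 <= _); last first.
  have -> : e1 * cq * J^-1 * q^-1 =
    e * (cq * J^-1 * q^-1) / (cq * J^-1 * q^-1 + 1) by rewrite /e1; ring.
  by rewrite ler_pdivrMr// mulrDr mulr1 lerDl ltW.
apply: (@tube_estimate R D mu hmu gam (rho n) d3 m) => //.
- by move=> w; have [] := rsm w [::].
- move=> y /rn[[/= + +] _ ?]; rewrite !subr0 => ? ?; split => //.
- move=> z w t /rn[/= /hd3[z1 z2] hw ht].
  have hw' : Vball (maxn nN nh) w0 w.
    apply: (VballS (leqnSn _)); rewrite -(mapV_Vball gam) /preimage/= mapV0.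
    exact: hw.
  move: d3d; rewrite !le_min => /andP[/andP[da db] dc].
  move: z1 z2; rewrite !lt_min => /andP[/andP[z1a z1b] _] /andP[/andP[z2a z2b] _].
  split.
  + apply: hAB; split => /=; first by apply: hA.
    by apply: hB; apply: VballS hw'; exact: leq_maxl.
  + have := lt_le_trans ht dc.
    by rewrite /= in_itv/= ltr_norml => /andP[]; lra.
  + move=> x; have := @hper z w0 (w - w0) (x, t).
    rewrite [w0 + _]addrC subrK; apply.
    by apply: Vxi_nbhdS hw'; exact: leq_maxr.
  + move=> x /andP[x1 xq]; case: (z) (z0) z1a z2a hd1 => [z1 z2] [u1 u2] /= z1a z2a hd1.
    apply: (hd1 (z1, z2)) => //=; last by rewrite x1 ltW.
    by rewrite distrC (lt_le_trans ht).
Qed.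
End Pullback.

Theorem lemma5 (R : realType) (D : frobLattice R)
    (mu : {measure set (borelVxi D) -> \bar R}) (hmu : is_haar mu)
    (z0 : R[i]) (v0 : tate D)
    (hper : flow (- ln ((fl_q D)%:R : R)) (spt (z0, Vxi_of v0, 1))
            = spt (z0, Vxi_of v0, 1))
    (gam : R[i]) (hgam : exists2 g, Gam D g & gam = (xi D)^-1 * g)
    (hz0 : (xi D)^-1 * z0 = z0 + gam)
    (hv0 : Vxi_inv (Vxi_of v0) = Vxi_of v0 - Vnat D gam) :
  let q : R := (fl_q D)%:R in
  let J : R := complex.Re `|(xi D)^-1 - 1| ^+ 2 in
  [/\ bijective (mapC D gam),
      bijective (@mapV R D gam),
      has_jacobianC (mapC D gam) J &
      has_jacobianV mu (@mapV R D gam) q] /\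
  (forall (N : set (R[i] * Vxi D)) (eps : R),
     open N -> N (z0, Vxi_of v0) -> 0 < eps ->
     isolated_orbit N eps (spt (z0, Vxi_of v0, 1)) ->
     pullback_dirac_eq mu N `]- eps - ln q, eps - ln q[ (@diff_map R D gam)
       (fun h => J^-1 * (q^-1 * dirac_orbit z0 (Vxi_of v0) (- ln q) h))).
Proof.
move=> q J; split.
  split; [exact: mapC_bij|exact: mapV_bij|exact: jacobian_mapC|exact: jacobian_mapV].
move=> N eps oN Nzv eps0 _; apply: pullback_dirac => //.
  by rewrite /mapC hz0 addrK subrr.
by rewrite /mapV hv0 subrK subrr.
Qed.
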